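(* Let $A=k\oplus\mathfrak{m}$ be an associative unital summability algebra over $k$ with unital evaluations. Then the multipliability exponential group $1+\mathfrak{m}$ has evaluations. Moreover, for all multipliable families $f$ in $1+\mathfrak{m}$, we have $$\mathrm{ev}^{\mathrm{Gr}}_f=\exp\circ\,\mathrm{ev}^{\mathrm{Lie}}_{\log\circ f}\circ\log.$$
   Context: $k$ is a fixed associative, commutative, unital $\mathbb{Q}$-algebra. **Summability algebras.** For a $k$-module $V$ and a set $I$, $V^{(I)}\subseteq V^I$ is the set of finitely supported maps. A summability structure on $V$ is a class $\Sigma=(\Sigma_I)_{I \text{ a set}}$ of partial maps $\Sigma_I: V^I\to V$, such that each $\operatorname{dom}\Sigma_I$ is a submodule of $V^I$, $\Sigma_I$ is $k$-linear on $\operatorname{dom}\Sigma_I$, and for all sets $I,J$: (SM1) $V^{(I)}\subseteq \operatorname{dom}\Sigma_I$ and $\Sigma_I v=\sum_{v(i)\neq 0}v(i)$ for $v\in V^{(I)}$. (SM2) If $\varphi:I\to J$ is a bijection and $v\in\operatorname{dom}\Sigma_J$, then $v\circ\varphi\in\operatorname{dom}\Sigma_I$ and $\Sigma_I(v\circ\varphi)=\Sigma_J v$. (SM3) If $I=\bigsqcup_{j\in J}I_j$ and $v\in\operatorname{dom}\Sigma_I$, then $v\upharpoonright I_j\in\operatorname{dom}\Sigma_{I_j}$ for each $j$, $(\Sigma_{I_j}(v\upharpoonright I_j))_{j\in J}\in\operatorname{dom}\Sigma_J$, and $\Sigma_J(\Sigma_{I_j}(v\upharpoonright I_j))_{j\in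 J}=\Sigma_I v$. (SM4) If $I\cap J=\varnothing$ and $(v,w)\in\operatorname{dom}\Sigma_I\times\operatorname{dom}\Sigma_J$, then $v\sqcup w\in\operatorname{dom}\Sigma_{I\sqcup J}$. (SM5) If $v\in\operatorname{dom}\Sigma_I$ and $f_i:X_i\to k$ ($i\in I$) are functions with finite domains, then $(f_i(x)v(i))_{i\in I, x\in X_i}\in\operatorname{dom}\Sigma_{\{(i,x): i\in I, x\in X_i\}}$. Elements of $\operatorname{dom}\Sigma_I$ are called summable families. A $k$-linear map $\phi$ is strongly linear if for every summable $v:I\to V$, $\phi\circ v$ is summable and $\Sigma_I(\phi\circ v)=\phi(\Sigma_I v)$. A summability algebra is an algebra $A$ (module with $k$-bilinear product) with a summability structure such that for all summable $a:I\to A$, $b:J\to A$, $(a(i)\cdot b(j))_{(i,j)\in I\times J}$ is summable with sum $(\Sigma_I a)\cdot(\Sigma_J b)$. A summability subalgebra (ideal) is a subalgebra (two-sided ideal) containing the sum of each of its families that is summable in $A$; it carries the restricted structure. **Formal series.** For a set $I$, $k\langle\!\langle I\rangle\!\rangle$ is the algebra of formal power series in non-commuting associative variables $X_i$, $i\in I$: all functions from the free monoid $I^\star$ to $k$, with the Cauchy product; a family $(P_j)_j$ is summable iff each word lies in the support of finitely many $P_j$, with pointwise sum. $k\langle\!\langle I\rangle\!\rangle_0$ is the set of series with zero constant term. $\mathrm{Lie}\langle\!\langle I\rangle\!\rangle$ is the smallest summability subalgebra of the summability Lie algebra $[k\langle\!\langle I\rangle\!\rangle]=(k\langle\!\langle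 I\rangle\!\rangle,[P,Q]=PQ-QP)$ containing all $X_i$. **Unital evaluations.** The notation $A=k\oplus\mathfrak{m}$ means that $A$ is unital and $\mathfrak{m}$ is a summability ideal complementing $k\cdot1$. For associative $A$, having unital evaluations means that for each set $I$ and each summable $a:I\to\mathfrak{m}$ there is a (unique) strongly linear algebra morphism $\mathrm{ev}_a:k\langle\!\langle I\rangle\!\rangle_0\to\mathfrak{m}$ with $X_i\mapsto a(i)$ (extended to $k\langle\!\langle I\rangle\!\rangle\to A$ by $1\mapsto1$); equivalently, for each such $a$ the family $(a(i_1)\cdots a(i_n))_{(i_1,\dots,i_n)\in I^\star}$ is summable. For $\varepsilon\in\mathfrak{m}$, $\exp(\varepsilon)=\sum_n\varepsilon^n/n!\in1+\mathfrak{m}$ and $\log(1+\varepsilon)=\sum_n\frac{(-1)^n}{n+1}\varepsilon^{n+1}\in\mathfrak{m}$; these are mutually inverse bijections $\mathfrak{m}\leftrightarrow1+\mathfrak{m}$. The same notation is used in $k\langle\!\langle I\rangle\!\rangle=k\oplus k\langle\!\langle I\rangle\!\rangle_0$. The summability Lie algebra $[\mathfrak{m}]=(\mathfrak{m},[a,b]=ab-ba)$ has Lie evaluations: for each summable $a:I\to\mathfrak{m}$, $\mathrm{ev}^{\mathrm{Lie}}_a:\mathrm{Lie}\langle\!\langle I\rangle\!\rangle\to[\mathfrak{m}]$ is the unique strongly linear Lie algebra morphism with $X_i\mapsto a(i)$. **The multipliability exponential group $1+\mathfrak{m}$.** It is a group under the product of $A$, with powers $(1+\varepsilon)^\lambda=\exp(\lambda\log(1+\varepsilon))$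 for $\lambda\in k$. A family $f:I\to1+\mathfrak{m}$ is multipliable iff $f-1=(f(i)-1)_i$ is summable; for a linear ordering $<$ on $I$, its ordered product is $\Pi_{(I,<)}f=\mathrm{ev}_{f-1}\big(\sum_{i_1<\dots<i_n}X_{i_1}\cdots X_{i_n}\big)$ (sum over all finite increasing sequences of elements of $I$, including the empty one). This applies in particular to $1+k\langle\!\langle I\rangle\!\rangle_0$, and $\mathrm{Gr}\langle\!\langle I\rangle\!\rangle:=\exp(\mathrm{Lie}\langle\!\langle I\rangle\!\rangle)$ is a subgroup of it closed under powers and ordered products of multipliable families, with the restricted structure. **Group evaluations.** A map $\Phi$ between such groups is strongly multiplicative if for every multipliable $g$ and every linear ordering of its index set, $\Phi\circ g$ is multipliable with ordered product the image under $\Phi$ of that of $g$. The group $\mathcal{G}=1+\mathfrak{m}$ has evaluations if for every set $I$ and every multipliable $f:I\to\mathcal{G}$ there is a (unique) strongly multiplicative group homomorphism commuting with all powers $\lambda\in k$, $\mathrm{ev}^{\mathrm{Gr}}_f:\mathrm{Gr}\langle\!\langle I\rangle\!\rangle\to\mathcal{G}$, with $\mathrm{ev}^{\mathrm{Gr}}_f(\exp(X_i))=f(i)$ for all $i\in I$. *)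

(* Defs.v *)
From HB Require Import structures.
From mathcomp Require Import all_boot all_order all_algebra.
From mathcomp Require Import boolp classical_sets functions cardinality fsbigop.

Set Implicit Arguments.
Unset Strict Implicit.
Unset Printing Implicit Defensive.

Import GRing.Theory.
Local Open Scope classical_set_scope.
Local Open Scope ring_scope.

(* Sets are types, and the partial map Sigma_I is the pair of its domain
   [summable] and a total function [ssum]; the values of [ssum] off the domain
   are junk and no axiom constrains them. *)
Record summability (V : Type) := Summability {
  summable : forall I : Type, (I -> V) -> Prop;
  ssum : forall I : Type, (I -> V) -> V
}.

Arguments summable {V} s {I} v.
Arguments ssum {V} s {I} v.

Section SummabilityAxioms.
Context {k : pzRingType} {V : lmodType k}.

(* A decomposition of I into disjoint, possibly empty, pieces I_j (j in J) is
   given by the map p : I -> J with I_j = {i | p i = j}; disjoint unions of two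
   sets are sum types, and dependent pairs are sigma types. *)
Record is_summability (S : summability V) : Prop := {
  summable_linear : forall (I : Type) (c : k) (v w : I -> V),
    summable S v -> summable S w -> summable S (fun i => c *: v i + w i);
  ssum_linear : forall (I : Type) (c : k) (v w : I -> V),
    summable S v -> summable S w ->
    ssum S (fun i => c *: v i + w i) = c *: ssum S v + ssum S w;
  summability_SM1 : forall (I : Type) (v : I -> V),
    finite_set [set i | v i != 0] ->
    summable S v /\ ssum S v = \sum_(i \in [set: {classic I}]) v i;
  summability_SM2 : forall (I J : Type) (phi : I -> J) (v : J -> V),
    bijective phi -> summable S v ->
    summable S (v \o phi) /\ ssum S (v \o phi) = ssum S v;
  summability_SM3 : forall (I J : Type) (p : I -> J) (v : I -> V),
    summable S v ->
    [/\ forall j, summable S (fun i : {i : I | p i = j} => v (sval i)),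
        summable S (fun j => ssum S (fun i : {i : I | p i = j} => v (sval i)))
      & ssum S (fun j => ssum S (fun i : {i : I | p i = j} => v (sval i)))
          = ssum S v];
  summability_SM4 : forall (I J : Type) (v : I -> V) (w : J -> V),
    summable S v -> summable S w ->
    summable S (fun x : I + J => match x with inl i => v i | inr j => w j end);
  summability_SM5 : forall (I : Type) (v : I -> V) (X : I -> finType)
      (f : forall i, X i -> k),
    summable S v ->
    summable S (fun p : {i : I & X i} => f (projT1 p) (projT2 p) *: v (projT1 p))
}.

End SummabilityAxioms.

Definition is_summability_algebra {k : nzRingType} {A : algType k}
    (S : summability A) : Prop :=
  is_summability S /\
  forall (I J : Type) (a : I -> A) (b : J -> A),
    summable S a -> summable S b ->
    summable S (fun p : I * J => a p.1 * b p.2) /\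
    ssum S (fun p : I * J => a p.1 * b p.2) = ssum S a * ssum S b.

(* The product is a parameter [mul], so that the notions below apply both to
   associative algebras and to their Lie brackets. *)
Section Substructures.
Context {k : pzRingType}.

Record is_summability_subalgebra {V : lmodType k} (S : summability V)
    (mul : V -> V -> V) (L : set V) : Prop := {
  ssub_zero : L 0;
  ssub_linear : forall (c : k) x y, L x -> L y -> L (c *: x + y);
  ssub_mul : forall x y, L x -> L y -> L (mul x y);
  ssub_ssum : forall (I : Type) (v : I -> V),
    (forall i, L (v i)) -> summable S v -> L (ssum S v)
}.

Record is_summability_ideal {V : lmodType k} (S : summability V)
    (mul : V -> V -> V) (m : set V) : Prop := {
  sideal_zero : m 0;
  sideal_linear : forall (c : k) x y, m x -> m y -> m (c *: x + y);
  sideal_mull : forall a x, m x -> m (mul a x);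
  sideal_mulr : forall a x, m x -> m (mul x a);
  sideal_ssum : forall (I : Type) (v : I -> V),
    (forall i, m (v i)) -> summable S v -> m (ssum S v)
}.

(* Strongly linear algebra morphisms (L, mulV) -> (M, mulW), where L and M
   carry the summability structures restricted from V and W. *)
Record is_strong_morphism {V W : lmodType k}
    (SV : summability V) (SW : summability W)
    (mulV : V -> V -> V) (mulW : W -> W -> W) (L : set V) (M : set W)
    (phi : V -> W) : Prop := {
  smor_codom : forall x, L x -> M (phi x);
  smor_linear : forall (c : k) x y,
    L x -> L y -> phi (c *: x + y) = c *: phi x + phi y;
  smor_mul : forall x y,
    L x -> L y -> phi (mulV x y) = mulW (phi x) (phi y);
  smor_ssum : forall (I : Type) (v : I -> V),
    (forall i, L (v i)) -> summable SV v ->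
    summable SW (phi \o v) /\ ssum SW (phi \o v) = phi (ssum SV v)
}.

End Substructures.

Definition bracket {R : pzRingType} (x y : R) : R := x * y - y * x.

(* A = k (+) m, read as: m is a summability ideal complementing k.1 in A *)
Record is_split {k : nzRingType} {A : algType k} (S : summability A)
    (m : set A) : Prop := {
  split_ideal : is_summability_ideal S *%R m;
  split_add : forall a : A, exists (c : k) (x : A), m x /\ a = c%:A + x;
  split_cap : forall c : k, m c%:A -> c%:A = 0 :> A
}.

Definition series (k : comNzRingType) (I : Type) : Type := seq I -> k.

Section Series.
Context (k : comNzRingType) (I : Type).
Implicit Types P Q T : series k I.

HB.instance Definition _ := GRing.Lmodule.copy (series k I) (seq I -> k^o).

Definition series_one : series k I := fun w => (nilp w)%:R.

Definition series_mul P Q : series k I :=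
  fun w => \sum_(i < (size w).+1) P (take i w) * Q (drop i w).

Let shift (x : I) P : series k I := fun w => P (x :: w).

Let series_mul_nil P Q : series_mul P Q [::] = P [::] * Q [::].
Proof. by rewrite /series_mul big_ord_recl big_ord0 addr0. Qed.

Let series_mul_cons P Q x w :
  series_mul P Q (x :: w) = P [::] * Q (x :: w) + series_mul (shift x P) Q w.
Proof. by rewrite /series_mul big_ord_recl. Qed.

Let series_addE P Q w : (P + Q) w = P w + Q w. Proof. by []. Qed.

Let series_scaleE c P w : (c *: P) w = c * P w. Proof. by []. Qed.

Let series_mulDl : left_distributive series_mul +%R.
Proof.
move=> P Q T; apply/funext => w; rewrite series_addE /series_mul -big_split /=.
by apply: eq_bigr => i _; rewrite series_addE mulrDl.
Qed.

Let series_mulDr : right_distributive series_mul +%R.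
Proof.
move=> P Q T; apply/funext => w; rewrite series_addE /series_mul -big_split /=.
by apply: eq_bigr => i _; rewrite series_addE mulrDr.
Qed.

Let series_scaleAl c P Q : c *: series_mul P Q = series_mul (c *: P) Q.
Proof.
apply/funext => w; rewrite series_scaleE /series_mul mulr_sumr.
by apply: eq_bigr => i _; rewrite series_scaleE mulrA.
Qed.

Let series_scaleAr c P Q : c *: series_mul P Q = series_mul P (c *: Q).
Proof.
apply/funext => w; rewrite series_scaleE /series_mul mulr_sumr.
by apply: eq_bigr => i _; rewrite series_scaleE mulrCA.
Qed.

Let series_mulA : associative series_mul.
Proof.
move=> P Q T; apply/funext => w.
elim: w P Q T => [|x w IHw] P Q T; first by rewrite !series_mul_nil mulrA.
have shift_mul : shift x (series_mul P Q)
    = P [::] *: shift x Q + series_mul (shift x P) Q.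
  by apply/funext => u; rewrite /shift series_mul_cons.
rewrite !series_mul_cons shift_mul series_mulDl -series_scaleAl series_addE.
by rewrite series_scaleE series_mul_nil IHw mulrDr mulrA addrA.
Qed.

Let series_mul1l : left_id series_one series_mul.
Proof.
move=> P; apply/funext => w; rewrite /series_mul big_ord_recl /= take0 drop0.
rewrite mul1r big1 ?addr0 // => i _.
by rewrite /series_one /nilp size_take; case: w i => [|x w] [i] //= ltiw;
   case: ifP; rewrite mul0r.
Qed.

Let series_mul1r : right_id series_one series_mul.
Proof.
move=> P; apply/funext => w; rewrite /series_mul big_ord_recr /=.
rewrite take_size drop_size /= mulr1 big1 ?add0r // => i _.
by rewrite /series_one /nilp size_drop subn_eq0 leqNgt ltn_ord mulr0.
Qed.

Let series_one_neq0 : series_one != 0.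
Proof.
by apply/eqP => /(congr1 (@^~ [::])) /eqP; apply/negP; exact: oner_neq0.
Qed.

HB.instance Definition _ := GRing.Zmodule_isNzRing.Build (series k I)
  series_mulA series_mul1l series_mul1r series_mulDl series_mulDr
  series_one_neq0.

HB.instance Definition _ := GRing.Lmodule_isLalgebra.Build k (series k I)
  series_scaleAl.

HB.instance Definition _ := GRing.Lalgebra_isAlgebra.Build k (series k I)
  series_scaleAr.

Definition series_summability : summability (series k I) :=
  Summability
    (fun J (P : J -> series k I) => forall w, finite_set [set j | P j w != 0])
    (fun J (P : J -> series k I) => fun w => \sum_(j \in [set: {classic J}]) P j w).

Definition series0 : set (series k I) := [set P | P [::] = 0].

Definition series_var (i : I) : series k I := fun w => `[< w = [:: i] >]%:R.

Definition lie_series : set (series k I) :=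
  [set P | forall L : set (series k I),
     is_summability_subalgebra series_summability bracket L ->
     (forall i, L (series_var i)) -> L P].

(* the sum of X_{i_1} ... X_{i_n} over all i_1 < ... < i_n, n >= 0 *)
Definition increasing_series (lt : rel I) : series k I :=
  fun w => (sorted lt w)%:R.

End Series.

Definition is_strict_linear_order {I : Type} (lt : rel I) : Prop :=
  [/\ irreflexive lt, transitive lt & forall i j, i <> j -> lt i j || lt j i].

Section Evaluations.
Context {k : comNzRingType} {A : algType k}.
Variables (S : summability A) (m : set A).

Definition is_evaluation (I : Type) (a : I -> A) (ev : series k I -> A) : Prop :=
  is_strong_morphism (series_summability k I) S *%R *%R (@series0 k I) m ev /\
  forall i, ev (series_var k i) = a i.

(* Only existence is required; uniqueness is automatic. *)
Definition has_unital_evaluations : Prop :=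
  forall (I : Type) (a : I -> A),
    (forall i, m (a i)) -> summable S a -> exists ev, is_evaluation a ev.

(* ev_a, extended to all series by 1 |-> 1; [xget] picks an evaluation on
   series without constant term, 0 being its junk value if there is none. *)
Definition unital_ev (I : Type) (a : I -> A) (P : series k I) : A :=
  (P [::])%:A
    + xget (fun=> 0) [set ev | is_evaluation a ev] (P - (P [::])%:A).

Definition is_lie_evaluation (I : Type) (a : I -> A) (ev : series k I -> A) :
    Prop :=
  is_strong_morphism (series_summability k I) S bracket bracket
    (@lie_series k I) m ev /\
  forall i, ev (series_var k i) = a i.

(* 1 + m *)
Definition one_plus : set A := [set g | m (g - 1)].

Definition multipliable (I : Type) (f : I -> A) : Prop :=
  (forall i, one_plus (f i)) /\ summable S (fun i => f i - 1).

Definition ordered_prod (I : Type) (lt : rel I) (f : I -> A) : A :=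
  unital_ev (fun i => f i - 1) (increasing_series k lt).

End Evaluations.

Section ExpLog.
Context {k : comAlgType rat} {A : algType k}.
Variable S : summability A.

Definition sexp (x : A) : A :=
  ssum S (fun n : nat => (n`!%:R^-1 : rat)%:A *: x ^+ n).

Definition slog (g : A) : A :=
  ssum S (fun n : nat => ((-1) ^+ n / n.+1%:R : rat)%:A *: (g - 1) ^+ n.+1).

Definition gpow (g : A) (c : k) : A := sexp (c *: slog g).

End ExpLog.

Definition group_series (k : comAlgType rat) (I : Type) : set (series k I) :=
  sexp (series_summability k I) @` @lie_series k I.

Section GroupEvaluations.
Context {k : comAlgType rat} {A : algType k}.
Variables (S : summability A) (m : set A).

Record is_group_evaluation (I : Type) (f : I -> A) (Phi : series k I -> A) :
    Prop := {
  gev_codom : forall g, group_series g -> one_plus m (Phi g);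
  gev_mul : forall g h, group_series g -> group_series h ->
    Phi (g * h) = Phi g * Phi h;
  gev_pow : forall g c, group_series g ->
    Phi (gpow (series_summability k I) g c) = gpow S (Phi g) c;
  gev_prod : forall (J : Type) (g : J -> series k I) (lt : rel J),
    (forall j, group_series (g j)) ->
    multipliable (series_summability k I) (@series0 k I) g ->
    is_strict_linear_order lt ->
    multipliable S m (Phi \o g) /\
    ordered_prod S m lt (Phi \o g)
      = Phi (ordered_prod (series_summability k I) (@series0 k I) lt g);
  gev_var : forall i,
    Phi (sexp (series_summability k I) (series_var k i)) = f i
}.

(* Morphisms out of Gr<<I>> are represented by maps on all series, which
   matter only on Gr<<I>>; hence the form of uniqueness. *)
Definition has_group_evaluations : Prop :=
  forall (I : Type) (f : I -> A), multipliable S m f ->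
    (exists Phi, is_group_evaluation f Phi) /\
    forall Phi Psi, is_group_evaluation f Phi -> is_group_evaluation f Psi ->
      forall g, group_series g -> Phi g = Psi g.

End GroupEvaluations.

(* Main.v *)
Require Import Defs.
From HB Require Import structures.
From mathcomp Require Import all_boot all_order all_algebra.
From mathcomp Require Import boolp classical_sets functions cardinality fsbigop.
From mathcomp Require Import ring.
From mathcomp Require wochoice.

(* If b = log o f, the strongly linear algebra morphism E = ev_b restricts to
   the Lie evaluation at b on Lie<<I>> and to a group evaluation at f on
   Gr<<I>>, and it commutes with exp and log, which is the formula.

   Uniqueness of group evaluations says that Gr<<I>> is generated by the exp X_i
   under products, powers and ordered products.  To see this one needs to
   recognize Lie<<I>> and Gr<<I>> intrinsically.  Let series act on
   k<<I>> + k d, where d is a derivation with [X_i, d] = X_i, by letting the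
   letters act by brackets.  Then P is a Lie series iff it acts as [P, -], and
   g is in Gr<<I>> iff it acts as conjugation by g; the value at d recovers the
   Dynkin map to right-normed brackets.  Hence the leading term of an element of
   Gr<<I>> is a combination of right-normed brackets, these are leading terms of
   iterated commutators of the exp X_i, and every element of Gr<<I>> is a
   product of such approximations, one for each degree. *)

Set Implicit Arguments.
Unset Strict Implicit.
Unset Printing Implicit Defensive.

Import GRing.Theory Num.Theory.
Local Open Scope classical_set_scope.
Local Open Scope ring_scope.

(** * Finitary functionals on series *)

(** Gr<<I>> is given only as exp of a smallest summability Lie algebra, so its stability under
    products is not visible and would ordinarily call for the Baker-Campbell-Hausdorff formula. The
    relation behind [ad_grouplike] replaces it: it is multiplicative and, at each word, involves
    finitely many coefficients, so it passes to infinite ordered products. The relation behind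
    [ad_primitive] is linear and passes to brackets and infinite sums. On k<<I>> alone neither
    relation would express P by brackets; at d the second one becomes the Dynkin-Specht-Wever
    identity, from which P is recovered by dividing degree n by n.

    Since [I] may be infinite, sums and products over all letters must converge: they do because
    every word in the i-th member contains the letter i.

    Identities between exp and log are proved in a single variable, where everything commutes, as
    differential equations for the Euler derivation, and reach other algebras by evaluating that
    variable. *)

Lemma finite_supportE (J : Type) (R : nmodType) (f : J -> R) :
  finite_set [set j | f j != 0] <->
  exists2 s : seq {classic J}, uniq s & forall j, j \notin s -> f j = 0.
Proof.
split=> [/(@finite_seqP {classic J})[s sE]|[s _ s0]].
  exists (undup s); first exact: undup_uniq.
  move=> j; rewrite mem_undup => js; apply/eqP; apply: contraNT js => fj.
  by have: [set` s] j by rewrite -sE.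
apply/(@finite_seqP {classic J}); exists [seq j <- s | f j != 0].
apply/seteqP; split=> j /=; rewrite mem_filter; last by case/andP.
by move=> fj; rewrite fj; apply: contraNT fj => /s0 ->.
Qed.

Lemma fsumE (J : Type) (R : nmodType) (f : J -> R) (s : seq {classic J}) :
  uniq s -> (forall j, j \notin s -> f j = 0) ->
  \sum_(j \in [set: {classic J}]) f j = \sum_(j <- s) f j.
Proof.
move=> us s0; rewrite (@fsbigE _ _ _ _ _ s) //; last by move=> j _ /s0.
by apply: eq_bigl => j; rewrite in_setT.
Qed.

Section Coefficients.
Context {k : comNzRingType}.
Implicit Types I J : Type.

Lemma series_mulE I (P Q : series k I) w :
  (P * Q) w = \sum_(i < (size w).+1) P (take i w) * Q (drop i w).
Proof. by []. Qed.

Lemma series_addE I (P Q : series k I) w : (P + Q) w = P w + Q w.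
Proof. by []. Qed.

Lemma series_oppE I (P : series k I) w : (- P) w = - P w.
Proof. by []. Qed.

Lemma series_scaleE I c (P : series k I) w : (c *: P) w = c * P w.
Proof. by []. Qed.

Lemma series_0E I w : (0 : series k I) w = 0.
Proof. by []. Qed.

Lemma series_1E I w : (1 : series k I) w = (nilp w)%:R.
Proof. by []. Qed.

End Coefficients.

Definition seriesE := (@series_addE, @series_oppE, @series_scaleE, @series_0E,
  @series_1E).

Section Finitary.
Context {k : comNzRingType}.
Implicit Types I J : Type.

Lemma series_sumE I (T : Type) (s : seq T) (B : pred T) (P : T -> series k I) w :
  (\sum_(j <- s | B j) P j) w = \sum_(j <- s | B j) P j w.
Proof. by elim/big_rec2: _ => // j y1 y2 _ <-. Qed.

Lemma series_mul0 I (P Q : series k I) : (P * Q) [::] = P [::] * Q [::].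
Proof. by rewrite series_mulE big_ord_recl big_ord0 addr0. Qed.

Lemma series_ssumE I J (P : J -> series k I) (s : seq {classic J}) w :
  uniq s -> (forall j, j \notin s -> P j w = 0) ->
  ssum (series_summability k I) P w = \sum_(j <- s) P j w.
Proof. exact: fsumE. Qed.

Lemma summable_on_seq I J (P : J -> series k I) (l : seq (seq I)) :
  summable (series_summability k I) P ->
  exists2 s : seq {classic J}, uniq s &
    forall j, j \notin s -> all (fun w => P j w == 0) l.
Proof.
move=> sP; elim: l => [|w l [s us s0]]; first by exists [::].
have [s' us' s0'] := (finite_supportE _).1 (sP w).
exists (undup (s ++ s')) => [|j]; first exact: undup_uniq.
rewrite mem_undup mem_cat negb_or => /andP[js js'] /=.
by rewrite s0' // eqxx s0.
Qed.

(** The functionals continuous for coefficientwise convergence. They commute with infinite sums, so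
    an operator with finitary coefficients is strongly linear ([strong_op]), and they are determined
    by their values on monomials ([finitary_ext]). *)
Definition finitary I (phi : series k I -> k) : Prop :=
  exists l : seq (k * seq I), forall P, phi P = \sum_(p <- l) p.1 * P p.2.

Lemma finitary_coef I w : finitary (fun P : series k I => P w).
Proof. by exists [:: (1, w)] => P; rewrite big_seq1 mul1r. Qed.

Lemma finitary0 I : finitary (fun P : series k I => 0).
Proof. by exists [::] => P; rewrite big_nil. Qed.

Lemma finitaryD I (phi psi : series k I -> k) :
  finitary phi -> finitary psi -> finitary (fun P => phi P + psi P).
Proof.
by case=> l lE [l' lE']; exists (l ++ l') => P; rewrite big_cat /= lE lE'.
Qed.

Lemma finitaryZ I c (phi : series k I -> k) :
  finitary phi -> finitary (fun P => c * phi P).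
Proof.
case=> l lE; exists [seq (c * p.1, p.2) | p <- l] => P; rewrite big_map lE.
by rewrite mulr_sumr; apply: eq_bigr => p _; rewrite mulrA.
Qed.

Lemma finitaryN I (phi : series k I -> k) :
  finitary phi -> finitary (fun P => - phi P).
Proof.
by move/(finitaryZ (-1)); congr finitary; apply/funext => P; rewrite mulN1r.
Qed.

Lemma finitary_sum I (T : Type) (s : seq T) (phi : T -> series k I -> k) :
  (forall j, finitary (phi j)) -> finitary (fun P => \sum_(j <- s) phi j P).
Proof.
move=> phif; elim: s => [|j s IHs].
  by have := finitary0 I; congr finitary; apply/funext => P; rewrite big_nil.
have := finitaryD (phif j) IHs.
by congr finitary; apply/funext => P; rewrite big_cons.
Qed.

Lemma finitary_comp I J (L : series k I -> series k J) (phi : series k J -> k) :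
  (forall w, finitary (fun P => L P w)) -> finitary phi ->
  finitary (fun P => phi (L P)).
Proof.
move=> Lf [l lE].
have := @finitary_sum I _ l _ (fun p => finitaryZ p.1 (Lf p.2)).
by congr finitary; apply/funext => P; rewrite lE.
Qed.

Lemma finitary_mull I (Q : series k I) w :
  finitary (fun P : series k I => (P * Q) w).
Proof.
have := @finitary_sum I _ (index_enum 'I_(size w).+1) _
  (fun i => finitaryZ (Q (drop i w)) (finitary_coef (take i w))).
by congr finitary; apply/funext => P; apply: eq_bigr => i _; rewrite mulrC.
Qed.

Lemma finitary_mulr I (P : series k I) w :
  finitary (fun Q : series k I => (P * Q) w).
Proof.
exact: (@finitary_sum I _ (index_enum 'I_(size w).+1) _
  (fun i => finitaryZ (P (take i w)) (finitary_coef (drop i w)))).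
Qed.

Lemma finitary_linear I (phi : series k I -> k) c P Q :
  finitary phi -> phi (c *: P + Q) = c * phi P + phi Q.
Proof.
case=> l lE; rewrite !lE mulr_sumr -big_split /=; apply: eq_bigr => p _.
by rewrite !seriesE mulrDr mulrCA.
Qed.

Lemma finitary_ssum I J (phi : series k I -> k) (P : J -> series k I) :
  finitary phi -> summable (series_summability k I) P ->
  exists s : seq {classic J}, [/\ uniq s, forall j, j \notin s -> phi (P j) = 0
    & phi (ssum (series_summability k I) P) = \sum_(j <- s) phi (P j)].
Proof.
case=> l lE sP.
have [s us s0'] := summable_on_seq [seq p.2 | p <- l] sP.
have s0 j : j \notin s -> all (fun p => P j p.2 == 0) l.
  by move/s0'; rewrite all_map.
exists s; split=> //.
  move=> j /s0; rewrite lE; elim: (l) => [|p l' IHl] /=; first by rewrite big_nil.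
  by case/andP=> /eqP Pp Pl; rewrite big_cons Pp mulr0 add0r IHl.
rewrite lE; under [RHS]eq_bigr do rewrite lE.
rewrite exchange_big /=; elim: l s0 {lE s0'} => [|p l IHl] s0; first by rewrite !big_nil.
rewrite !big_cons IHl => [|j /s0 /=]; last by case/andP.
congr (_ + _); rewrite -mulr_sumr; congr (_ * _).
by apply: series_ssumE => // j /s0 /= /andP[/eqP].
Qed.

Lemma strong_op I J (T : Type) (L : series k I -> series k J)
    (P : T -> series k I) :
  (forall w, finitary (fun P => L P w)) ->
  summable (series_summability k I) P ->
  summable (series_summability k J) (L \o P) /\
  ssum (series_summability k J) (L \o P)
    = L (ssum (series_summability k I) P).
Proof.
move=> Lf sP; split=> [w|].
  have [s [us s0 _]] := finitary_ssum (Lf w) sP.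
  by apply/finite_supportE; exists s.
apply/funext => w; have [s [us s0 ->]] := finitary_ssum (Lf w) sP.
exact: series_ssumE.
Qed.

Lemma op_linear I J (L : series k I -> series k J) c P Q :
  (forall w, finitary (fun P => L P w)) -> L (c *: P + Q) = c *: L P + L Q.
Proof.
by move=> Lf; apply/funext => w; rewrite (finitary_linear _ _ _ (Lf w)).
Qed.

Definition monomial I (v : seq I) : series k I := fun w => `[< w = v >]%:R.

Lemma monomial_nil I : monomial [::] = 1 :> series k I.
Proof. by apply/funext => -[|x w]; rewrite /monomial seriesE; case: asboolP. Qed.

Lemma series_decomp I (P : series k I) :
  summable (series_summability k I) (fun v => P v *: monomial v) /\
  ssum (series_summability k I) (fun v => P v *: monomial v) = P.
Proof.
have s0 w v : v \notin [:: w : {classic seq I}] -> (P v *: monomial v) w = 0.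
  rewrite inE seriesE /monomial => /eqP/nesym vw.
  by rewrite asboolF // mulr0.
split=> [w|]; first by apply/finite_supportE; exists [:: w : {classic seq I}] => //; exact: s0.
apply/funext => w; rewrite (@series_ssumE _ _ _ [:: w : {classic seq I}]) //.
  by rewrite big_seq1 seriesE /monomial asboolT // mulr1.
exact: s0.
Qed.

Lemma finitary_ext I (phi psi : series k I -> k) :
  finitary phi -> finitary psi ->
  (forall v, phi (monomial v) = psi (monomial v)) -> phi = psi.
Proof.
move=> phif psif eqv; apply/funext => P.
have [sP <-] := series_decomp P.
have chif := finitaryD phif (finitaryN psif).
have [s [us s0 E]] := finitary_ssum chif sP.
apply/eqP; rewrite -subr_eq0 E big1 // => v _.
have phi0 : forall chi : series k I -> k, finitary chi ->
    forall c Q, chi (c *: Q) = c * chi Q.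
  by move=> chi [l lE] c Q; rewrite !lE mulr_sumr; apply: eq_bigr => p _;
     rewrite mulrCA.
by rewrite !phi0 // eqv subrr.
Qed.

End Finitary.

(** * Evaluations *)

(** An [eqType] has two decidable equalities here, its own and that of [{classic T}]; both reflect
    [=], so membership agrees. *)
Lemma mem_classic (T : eqType) (s : seq T) (x : T) :
  (x \in (s : seq {classic T})) = (x \in s).
Proof.
elim: s => [//|y s IHs]; rewrite [LHS](@in_cons {classic T}) in_cons; congr (_ || _) => //.
by apply/eqP/eqP.
Qed.

Section Words.
Context {T : eqType}.
Implicit Types (s v : seq T).

(** These finite lists are closed under prefixes and suffixes, so a coefficient of a product at a
    listed word involves only listed words. *)
Fixpoint words n s : seq (seq T) :=
  if n is n'.+1 then [::] :: [seq x :: v | x <- s, v <- words n' s]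
  else [:: [::]].

Lemma mem_words n s v : (v \in words n s) = (size v <= n)%N && all (mem s) v.
Proof.
elim: n v => [|n IHn] [|x v] //=.
rewrite inE /=; apply/allpairsP/idP => [[[y u] /= [ys us [-> ->]]]|].
  by move: us; rewrite IHn ltnS ys /=.
by case/and3P=> sv xs vs; exists (x, v); rewrite /= IHn -ltnS sv.
Qed.

Lemma words_take n s i v : v \in words n s -> take i v \in words n s.
Proof.
rewrite !mem_words => /andP[vn /allP vs]; apply/andP; split.
  by apply: leq_trans vn; rewrite size_take_min geq_minr.
by apply/allP => x /mem_take /vs.
Qed.

Lemma words_drop n s i v : v \in words n s -> drop i v \in words n s.
Proof.
rewrite !mem_words => /andP[vn /allP vs]; apply/andP; split.
  by apply: leq_trans vn; rewrite size_drop leq_subr.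
by apply/allP => x /mem_drop /vs.
Qed.

Lemma words_self v : v \in words (size v) v.
Proof. by rewrite mem_words leqnn; apply/allP. Qed.

End Words.

(** * Filtration of series by lowest degree *)

Section Order.
Context {k : comNzRingType} {I : Type}.
Implicit Types P Q : series k I.

Definition order_ge n P : Prop := forall w, (size w < n)%N -> P w = 0.

Lemma order_geW m n P : (m <= n)%N -> order_ge n P -> order_ge m P.
Proof. by move=> mn nP w wm; apply: nP; apply: leq_trans mn. Qed.

Lemma order_ge1 P : order_ge 1 P <-> P [::] = 0.
Proof. by split=> [->//|P0 [|//]]. Qed.

Lemma order_geM m n P Q :
  order_ge m P -> order_ge n Q -> order_ge (m + n) (P * Q).
Proof.
move=> mP nQ w wmn; rewrite series_mulE big1 // => i _.
have iw : (i <= size w)%N by rewrite -ltnS.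
have [im|mi] := ltnP i m; first by rewrite mP ?mul0r // size_takel.
rewrite nQ ?mulr0 // size_drop ltn_subLR //.
by apply: leq_trans wmn _; rewrite leq_add2r.
Qed.

Lemma order_geMr n P Q : order_ge n P -> order_ge n (P * Q).
Proof. by move=> nP; rewrite -[n]addn0; apply: order_geM. Qed.

Lemma order_geMl n P Q : order_ge n Q -> order_ge n (P * Q).
Proof. by move=> nQ; rewrite -[n]add0n; apply: order_geM. Qed.

Lemma order_geB n P Q : order_ge n P -> order_ge n Q -> order_ge n (P - Q).
Proof. by move=> nP nQ w wn; rewrite !seriesE nP // nQ // subrr. Qed.

Lemma order_geD n P Q : order_ge n P -> order_ge n Q -> order_ge n (P + Q).
Proof. by move=> nP nQ w wn; rewrite !seriesE nP // nQ // addr0. Qed.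

Lemma mul_leading n P Q u :
  order_ge n P -> (size u <= n)%N -> (P * Q) u = P u * Q [::].
Proof.
move=> nP un; rewrite series_mulE big_ord_recr /= take_size drop_size.
rewrite big1 ?add0r // => i _; rewrite nP ?mul0r // size_takel.
  exact: leq_trans (ltn_ord i) un.
exact: ltnW.
Qed.

Lemma order_geX P n : P [::] = 0 -> order_ge n (P ^+ n).
Proof.
move=> P0; elim: n => [//|n IHn]; rewrite exprS -add1n.
by apply: order_geM => //; apply/order_ge1.
Qed.

End Order.

Section StrongMorphisms.
Context {k : comNzRingType} {A : algType k} (S : summability A) {I : Type}.

Definition unital_morphism (phi : series k I -> A) : Prop :=
  is_strong_morphism (series_summability k I) S *%R *%R setT setT phi /\
  phi 1 = 1.

Variable phi : series k I -> A.
Hypothesis phiP : unital_morphism phi.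

Lemma umorphP c P Q : phi (c *: P + Q) = c *: phi P + phi Q.
Proof. exact: smor_linear phiP.1 _ _ _ _ _. Qed.

Lemma umorphD P Q : phi (P + Q) = phi P + phi Q.
Proof. by have := umorphP 1 P Q; rewrite !scale1r. Qed.

Lemma umorph0 : phi 0 = 0.
Proof. by apply: (@addrI _ (phi 0)); rewrite -umorphD !addr0. Qed.

Lemma umorphZ c P : phi (c *: P) = c *: phi P.
Proof. by have := umorphP c P 0; rewrite umorph0 !addr0. Qed.

Lemma umorphB P Q : phi (P - Q) = phi P - phi Q.
Proof. by rewrite -scaleN1r addrC umorphP scaleN1r addrC. Qed.

Lemma umorphM P Q : phi (P * Q) = phi P * phi Q.
Proof. exact: smor_mul phiP.1 _ _ _ _. Qed.

Lemma umorph1 : phi 1 = 1.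
Proof. exact: phiP.2. Qed.

Lemma umorphX P n : phi (P ^+ n) = phi P ^+ n.
Proof.
by elim: n => [|n IHn]; rewrite ?expr0 ?umorph1 // !exprS umorphM IHn.
Qed.

Lemma umorph_prod (T : Type) (s : seq T) (P : T -> series k I) :
  phi (\prod_(j <- s) P j) = \prod_(j <- s) phi (P j).
Proof.
elim: s => [|j s IHs]; first by rewrite !big_nil umorph1.
by rewrite !big_cons umorphM IHs.
Qed.

Lemma umorph_ssum (J : Type) (P : J -> series k I) :
  summable (series_summability k I) P ->
  summable S (phi \o P) /\
  ssum S (phi \o P) = phi (ssum (series_summability k I) P).
Proof. by move=> sP; apply: (smor_ssum phiP.1). Qed.

End StrongMorphisms.

(** * Substitution of series into series *)

Section SeriesEvaluation.
Context {k : comNzRingType} {I J : Type} (a : J -> series k I).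
Implicit Types (P Q : series k J).

Definition wordprod (v : seq J) : series k I := \prod_(j <- v) a j.

Definition series_ev P : series k I :=
  ssum (series_summability k I) (fun v => P v *: wordprod v).

Lemma wordprod_cons j v : wordprod (j :: v) = a j * wordprod v.
Proof. exact: big_cons. Qed.

(** In the expansion over factorizations of [u], every term contains a coefficient of some [a j],
    with [j] outside [s], at a word still in [U]. *)
Lemma wordprod_out (U : set (seq I)) (s : seq {classic J}) u v :
  (forall i u, U u -> U (take i u)) -> (forall i u, U u -> U (drop i u)) ->
  (forall j, j \notin s -> forall u, U u -> a j u = 0) ->
  U u -> ~~ all (mem s) v -> wordprod v u = 0.
Proof.
move=> Utake Udrop s0; elim: v u => [//|j v IHv] u Uu /=.
rewrite negb_and wordprod_cons series_mulE => jv; rewrite big1 // => i _.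
case/orP: jv => [js|vs]; first by rewrite (s0 j) ?mul0r //; apply: Utake.
by rewrite IHv ?mulr0 //; apply: Udrop.
Qed.

Hypothesis a0 : forall j, a j [::] = 0.
Hypothesis sa : summable (series_summability k I) a.

Lemma wordprod_order v : order_ge (size v) (wordprod v).
Proof.
elim: v => [//|j v IHv]; rewrite wordprod_cons -[size _]add1n.
by apply: order_geM => //; apply/order_ge1.
Qed.

(** Zero constant terms bound the length of [v] by that of [u], and summability leaves finitely many
    letters [j] for which [a j] is nonzero on the factors of [u]. *)
Lemma wordprod_support u : exists2 l : seq {classic seq J}, uniq l &
  forall v, v \notin l -> wordprod v u = 0.
Proof.
have [s us s0] :=
  summable_on_seq (words (size u) (u : seq {classic I})) sa.
pose l : seq (seq {classic J}) := words (size u) s.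
exists (@undup {classic seq J} l) => [|v]; first exact: undup_uniq.
rewrite mem_undup (@mem_classic _ l) mem_words negb_and -ltnNge.
case/orP => [uv|vs]; first by rewrite wordprod_order.
apply: (wordprod_out (U := [set w | w \in words (size u) (u : seq {classic I})])
  (s := s)) vs => /=.
- by move=> i w; apply: words_take.
- by move=> i w; apply: words_drop.
- by move=> j /s0 /allP js w /js /eqP.
- exact: words_self.
Qed.

Lemma finitary_series_ev u : finitary (fun P => series_ev P u).
Proof.
have [l ul l0] := wordprod_support u.
exists [seq (wordprod v u, v) | v <- l] => P; rewrite big_map.
rewrite /series_ev (series_ssumE (s := l)) // => [|v vl].
  by apply: eq_bigr => v _; rewrite seriesE mulrC.
by rewrite seriesE l0 ?mulr0.
Qed.

Lemma series_ev_monomial v : series_ev (monomial v) = wordprod v.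
Proof.
apply/funext => u; rewrite /series_ev.
rewrite (series_ssumE (s := [:: v : {classic seq J}])) // => [|w].
  by rewrite big_seq1 seriesE /monomial asboolT // mul1r.
by rewrite inE seriesE /monomial => /eqP wv; rewrite asboolF // mul0r.
Qed.

Lemma monomial_mul v w : monomial v * monomial w = monomial (v ++ w) :> series k J.
Proof.
elim: v => [|x v IHv]; first by rewrite monomial_nil mul1r.
apply/funext => -[|y u].
  by rewrite series_mul0 /monomial asboolF // mul0r asboolF.
rewrite series_mulE big_ord_recl /= {1}/monomial asboolF // mul0r add0r.
rewrite /bump /=.
have /(congr1 (fun P : series k J => P u)) := IHv.
rewrite /monomial series_mulE; have [<-{y}|xy] := EM (x = y).
  have cE (z z' : seq J) : `[< x :: z = x :: z' >] = `[< z = z' >].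
    by apply: asbool_equiv_eq; split=> [[]|->].
  by rewrite cE => <-; apply: eq_bigr => i _; rewrite cE.
move=> _; rewrite asboolF; last by case=> /esym.
by rewrite big1 // => i _; rewrite asboolF ?mul0r // => -[/esym].
Qed.

Lemma series_evM P Q : series_ev (P * Q) = series_ev P * series_ev Q.
Proof.
apply/funext => u.
(* Both sides are finitary in [P], then in [Q], so the identity reduces to a product of two
   monomials. *)
have lP Q' : (fun P => series_ev (P * Q') u) =
    (fun P => (series_ev P * series_ev Q') u) ->
    series_ev (P * Q') u = (series_ev P * series_ev Q') u.
  by move/(congr1 (@^~ P)).
apply: lP; apply: finitary_ext => [||v].
- apply: (finitary_comp (L := fun P => P * Q)) (finitary_series_ev u).
  exact: finitary_mull.
- apply: (finitary_comp (L := series_ev)) (finitary_mull _ u).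
  exact: finitary_series_ev.
have lQ : (fun Q => series_ev (monomial v * Q) u) =
    (fun Q => (series_ev (monomial v) * series_ev Q) u) ->
    series_ev (monomial v * Q) u = (series_ev (monomial v) * series_ev Q) u.
  by move/(congr1 (@^~ Q)).
apply: lQ; apply: finitary_ext => [||w].
- apply: (finitary_comp (L := fun Q => monomial v * Q)) (finitary_series_ev u).
  exact: finitary_mulr.
- apply: (finitary_comp (L := series_ev)) (finitary_mulr _ u).
  exact: finitary_series_ev.
by rewrite monomial_mul !series_ev_monomial /wordprod big_cat.
Qed.

Lemma series_ev_morphism : unital_morphism (series_summability k I) series_ev.
Proof.
split; last by rewrite -monomial_nil series_ev_monomial /wordprod big_nil.
split=> //.
- by move=> c P Q _ _; apply: op_linear; apply: finitary_series_ev.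
- by move=> P Q _ _; apply: series_evM.
- by move=> K P _ sP; apply: strong_op => // w; apply: finitary_series_ev.
Qed.

Lemma series_ev_var j : series_ev (series_var k j) = a j.
Proof.
have -> : series_var k j = monomial [:: j] by [].
by rewrite series_ev_monomial /wordprod big_seq1.
Qed.

Lemma series_ev_coef0 P : series_ev P [::] = P [::].
Proof.
rewrite /series_ev (series_ssumE (s := [:: [::] : {classic seq J}])) //.
  by rewrite big_seq1 seriesE /wordprod big_nil mulr1.
move=> [|j v]; first by rewrite inE eqxx.
by rewrite seriesE wordprod_order ?mulr0.
Qed.

Lemma series_ev_evaluation :
  is_evaluation (series_summability k I) (@series0 k I) a series_ev.
Proof.
split; last exact: series_ev_var.
have [[_ lin mul ss] _] := series_ev_morphism.
split=> [P|c P Q _ _|P Q _ _|K P _].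
- by rewrite /series0 /= series_ev_coef0.
- exact: lin.
- exact: mul.
- exact: ss.
Qed.

End SeriesEvaluation.

(** * Uniqueness of evaluations and their unital extension *)

Section UnitalEvaluation.
Context {k : comNzRingType} {A : algType k} (S : summability A) (m : set A).
Context {I : Type} {a : I -> A}.

(** A series is the sum of its monomials, and a nonempty monomial is a product of variables. *)
Lemma evaluation_uniq e e' :
  is_evaluation S m a e -> is_evaluation S m a e' ->
  {in @series0 k I, e =1 e'}.
Proof.
move=> [eP ev] [e'P e'v] P; rewrite inE => P0.
have lin0 (phi : series k I -> A) c (v : series k I) :
    is_strong_morphism (series_summability k I) S *%R *%R (@series0 k I) m phi ->
    v [::] = 0 -> phi (c *: v) = c *: phi v.
  move=> phiP v0; have z0 : @series0 k I 0 by [].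
  have phi0 : phi 0 = 0.
    apply: (@addrI _ (phi 0)).
    by have := smor_linear phiP 1 z0 z0; rewrite !scale1r !addr0 => <-.
  by have := smor_linear phiP c v0 z0; rewrite phi0 !addr0.
have mon v : v <> [::] -> e (monomial v) = e' (monomial v).
  elim: v => [//|x v IHv] _; have [->|v0] := EM (v = [::]).
    by rewrite ev e'v.
  have vE : monomial (x :: v) = series_var k x * monomial v.
    by rewrite (monomial_mul [:: x]).
  have x0 : @series0 k I (series_var k x).
    by rewrite /series0 /series_var /= asboolF.
  have mv0 : @series0 k I (monomial v).
    by rewrite /series0 /monomial /= asboolF //; apply/nesym.
  by rewrite vE (smor_mul eP) // (smor_mul e'P) // ev e'v IHv.
have [sP PE] := series_decomp P.
have f0 v : @series0 k I (P v *: monomial v).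
  rewrite /series0 /= seriesE /monomial.
  by case: v => [|x v]; rewrite ?P0 ?mul0r // asboolF // mulr0.
have [_] := smor_ssum eP f0 sP; have [_] := smor_ssum e'P f0 sP.
rewrite PE => <- <-; congr (ssum S _); apply/funext => v /=.
(* [monomial [::]] lies outside [series0], but its coefficient [P [::]] vanishes. *)
have [->|v0] := EM (v = [::]).
  rewrite P0 !scale0r; apply: etrans (_ : 0 = _).
    by rewrite -(scale0r (0 : series k I)) lin0 // scale0r.
  by rewrite -(scale0r (0 : series k I)) lin0 // scale0r.
have mv0 : @series0 k I (monomial v).
  by rewrite /series0 /monomial /= asboolF //; apply/nesym.
by rewrite !lin0 // mon.
Qed.

Hypothesis HA : is_summability_algebra S.

Lemma evaluation_morphism e : is_evaluation S m a e ->
  unital_morphism S (fun P => (P [::])%:A + e (P - (P [::])%:A)).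
Proof.
move=> [eP ev].
have z0 (P : series k I) : @series0 k I (P - (P [::])%:A).
  by rewrite /series0 /= !seriesE mulr1 subrr.
have e0 : e 0 = 0.
  have z : @series0 k I 0 by [].
  apply: (@addrI _ (e 0)).
  by have := smor_linear eP 1 z z; rewrite !scale1r !addr0 => <-.
have eD P Q : @series0 k I P -> @series0 k I Q -> e (P + Q) = e P + e Q.
  by move=> P0 Q0; have := smor_linear eP 1 P0 Q0; rewrite !scale1r.
have eZ c P : @series0 k I P -> e (c *: P) = c *: e P.
  move=> P0; have z : @series0 k I 0 by [].
  by have := smor_linear eP c P0 z; rewrite !addr0 e0 addr0.
split; last by rewrite (_ : (1 : series k I) [::] = 1) // !scale1r subrr e0 addr0.
split=> //.
- move=> c P Q _ _; rewrite !seriesE scalerDr addrACA -(smor_linear eP) //.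
  rewrite scalerDl scalerA; congr (_ + e _).
  by rewrite scalerBr scalerA scalerDl opprD addrACA.
- move=> P Q _ _; rewrite series_mul0.
  move: (z0 P) (z0 Q); set P0 := P - _; set Q0 := Q - _ => P00 Q00.
  have -> : P * Q - (P [::] * Q [::])%:A
      = P [::] *: Q0 + (Q [::] *: P0 + P0 * Q0).
    have PE : P = (P [::])%:A + P0 by rewrite /P0 addrCA subrr addr0.
    have QE : Q = (Q [::])%:A + Q0 by rewrite /Q0 addrCA subrr addr0.
    move: P00 Q00 PE QE; clearbody P0 Q0 => P00 Q00 PE QE.
    rewrite {1}PE {1}QE mulrDl !mulrDr -!scalerAl -!scalerAr !mul1r !mulr1.
    by rewrite scalerA addrC !addrA addNr add0r.
  have PQ0 : @series0 k I (P0 * Q0) by rewrite /series0 /= series_mul0 P00 mul0r.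
  have sQ : @series0 k I (Q [::] *: P0) by rewrite /series0 /= seriesE P00 mulr0.
  have sP : @series0 k I (P [::] *: Q0) by rewrite /series0 /= seriesE Q00 mulr0.
  have sum0 : @series0 k I (Q [::] *: P0 + P0 * Q0).
    by rewrite /series0 /= seriesE sQ PQ0 addr0.
  rewrite eD // eD // !eZ // (smor_mul eP) //.
  rewrite mulrDl !mulrDr -!scalerAl -!scalerAr !mul1r !mulr1 scalerA.
  by rewrite -!addrA.
- move=> K P _ sP.
  (* Only finitely many constant terms are nonzero, so (SM1) sums the scalar parts; [e] handles what
     remains. *)
  have [s us s0] := (finite_supportE _).1 (sP [::]).
  have fin : finite_set [set j | (P j [::])%:A != 0 :> A].
    by apply/finite_supportE; exists s => // j /s0 ->; rewrite scale0r.
  have [sum1 sum1E] := summability_SM1 HA.1 fin.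
  have s0P : summable (series_summability k I) (fun j => P j - (P j [::])%:A).
    case=> [|x w]; first by apply/finite_supportE; exists [::] => // j _;
      rewrite !seriesE mulr1 subrr.
    apply: sub_finite_set (sP (x :: w)) => j /=.
    by rewrite !seriesE mulr0 subr0.
  have ss0 : ssum (series_summability k I) (fun j => P j - (P j [::])%:A) =
      ssum (series_summability k I) P - (ssum (series_summability k I) P [::])%:A.
    apply/funext => -[|x w]; rewrite !seriesE.
      rewrite mulr1 subrr (series_ssumE (s := [::])) ?big_nil // => j _.
      by rewrite !seriesE mulr1 subrr.
    rewrite mulr0 subr0; have [s' us' s0'] := (finite_supportE _).1 (sP (x :: w)).
    rewrite !(series_ssumE (s := s')) // => [|j /s0']; rewrite ?seriesE.
      by apply: eq_bigr => j _; rewrite !seriesE mulr0 subr0.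
    by move=> ->; rewrite mulr0 subr0.
  have [sum2 sum2E] := smor_ssum eP (fun j => z0 (P j)) s0P.
  have := summable_linear HA.1 1 sum1 sum2.
  have := ssum_linear HA.1 1 sum1 sum2.
  have -> : (fun j => 1 *: (P j [::])%:A + (e \o (fun j => P j - (P j [::])%:A)) j)
      = (fun P : series k I => (P [::])%:A + e (P - (P [::])%:A)) \o P.
    by apply/funext => j /=; rewrite scale1r.
  move=> -> sum; split=> //.
  rewrite scale1r sum1E sum2E ss0; congr (_ + _).
  rewrite (fsumE (s := s)) // => [|j /s0 ->]; last by rewrite scale0r.
  by rewrite (series_ssumE (s := s)) // scaler_suml.
Qed.

Lemma unital_ev_morphism e : is_evaluation S m a e ->
  unital_morphism S (unital_ev S m a) /\
  {in @series0 k I, unital_ev S m a =1 e}.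
Proof.
move=> eP.
have xP := xgetI (fun=> 0 : A) eP.
split; first exact: evaluation_morphism.
move=> P; rewrite inE => P0; rewrite /unital_ev P0 !scale0r add0r subr0.
by apply: evaluation_uniq; rewrite ?inE.
Qed.

End UnitalEvaluation.

Lemma series_unital_evE {k : comNzRingType} {I J : Type} (a : J -> series k I) :
  (forall j, a j [::] = 0) -> summable (series_summability k I) a ->
  unital_ev (series_summability k I) (@series0 k I) a = series_ev a.
Proof.
move=> a0 sa; have aP := series_ev_evaluation a0 sa.
have xP := xgetI (fun=> 0 : series k I) aP.
apply/funext => P; rewrite /unital_ev (evaluation_uniq xP aP); last first.
  by rewrite inE /series0 /= !seriesE mulr1 subrr.
have evP := series_ev_morphism a0 sa.
rewrite (umorphB evP) (umorphZ evP) (umorph1 evP).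
by rewrite addrC subrK.
Qed.

(** * The Euler derivation, exponential and logarithm *)

Section Euler.
Context {k : comNzRingType} {I : Type}.
Implicit Types (P Q : series k I) (v : nat -> series k I).

Lemma order_ssum v :
  (forall n, order_ge n (v n)) -> summable (series_summability k I) v.
Proof.
move=> ov w; apply: (@sub_finite_set _ _ `I_(size w).+1); last exact: finite_II.
move=> n /=; apply: contraNT; rewrite -leqNgt => wn.
by rewrite ov.
Qed.

Lemma order_ssumE v N w : (forall n, order_ge n (v n)) -> (size w < N)%N ->
  ssum (series_summability k I) v w = \sum_(n < N) v n w.
Proof.
move=> ov wN; rewrite (series_ssumE (s := iota 0 N : seq {classic nat})).
- by rewrite -(big_mkord xpredT (fun n => v n w)) /index_iota subn0.
- apply/(uniqP (0 : {classic nat})) => i j.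
  by rewrite !inE size_iota => iN jN; rewrite !nth_iota.
move=> n; rewrite (@mem_classic _ (iota 0 N)) mem_iota add0n -leqNgt => Nn.
by rewrite ov // (leq_trans wN).
Qed.

Lemma ssum_natS v : (forall n, order_ge n (v n)) ->
  ssum (series_summability k I) v
    = v 0%N + ssum (series_summability k I) (fun n => v n.+1).
Proof.
move=> ov; apply/funext => w; rewrite seriesE (@order_ssumE _ (size w).+2) //.
rewrite big_ord_recl (@order_ssumE _ (size w).+1) // => n.
exact: order_geW (ov _).
Qed.

Lemma order_geZ n c P : order_ge n P -> order_ge n (c *: P).
Proof. by move=> nP w wn; rewrite seriesE nP // mulr0. Qed.

(** The derivation fixing every letter. Over the rationals its kernel is the constants, so series
    can be compared through the differential equations that they satisfy. *)
Definition euler P : series k I := fun w => (size w)%:R * P w.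

Lemma eulerE P w : euler P w = (size w)%:R * P w.
Proof. by []. Qed.

Lemma finitary_euler w : finitary (fun P => euler P w).
Proof. exact: finitaryZ (finitary_coef w). Qed.

Lemma eulerD P Q : euler (P + Q) = euler P + euler Q.
Proof. by apply/funext => w; rewrite /euler !seriesE mulrDr. Qed.

Lemma eulerZ c P : euler (c *: P) = c *: euler P.
Proof. by apply/funext => w; rewrite /euler !seriesE mulrCA. Qed.

Lemma eulerB P Q : euler (P - Q) = euler P - euler Q.
Proof. by rewrite -scaleN1r eulerD eulerZ scaleN1r. Qed.

Lemma euler1 : euler 1 = 0.
Proof.
by apply/funext => -[|x w]; rewrite eulerE !seriesE /= ?mul0r ?mulr0.
Qed.

Lemma euler_coef0 P : euler P [::] = 0.
Proof. by rewrite eulerE mul0r. Qed.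

Lemma euler_order n P : order_ge n P -> order_ge n (euler P).
Proof. by move=> nP w wn; rewrite eulerE nP // mulr0. Qed.

Lemma eulerM P Q : euler (P * Q) = euler P * Q + P * euler Q.
Proof.
apply/funext => w; rewrite seriesE eulerE !series_mulE mulr_sumr -big_split /=.
apply: eq_bigr => i _; rewrite !eulerE.
have -> : (size w)%:R = (size (take i w))%:R + (size (drop i w))%:R :> k.
  by rewrite -natrD -size_cat cat_take_drop.
by rewrite mulrDl mulrA mulrCA.
Qed.

Lemma eulerX P n : P * euler P = euler P * P ->
  euler (P ^+ n.+1) = n.+1%:R *: (euler P * P ^+ n).
Proof.
move=> cP; elim: n => [|n IHn]; first by rewrite expr1 expr0 mulr1 mulr1n scale1r.
rewrite exprS eulerM IHn -scalerAr mulrA cP -mulrA -exprS.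
by rewrite -[in RHS]natr1 scalerDl scale1r addrC.
Qed.

End Euler.

(** Words over [unit] are determined by their length, so reversing the Cauchy sum exchanges the
    factors. *)
Lemma series_unit_mulC {k : comNzRingType} (P Q : series k unit) :
  P * Q = Q * P.
Proof.
have wE (w : seq unit) : w = nseq (size w) tt by elim: w => //= -[] w {1}->.
apply/funext => w; rewrite !series_mulE (reindex_inj rev_ord_inj) /=.
apply: eq_bigr => i _; rewrite mulrC subSS.
have iw : (i <= size w)%N by rewrite -ltnS.
congr (Q _ * P _); rewrite [LHS]wE [RHS]wE; congr nseq.
  by rewrite size_drop size_takel // subKn.
by rewrite size_drop size_takel // leq_subr.
Qed.

Section ExpLogSeries.
Context {k : comAlgType rat}.

Lemma alg_mul_nat n (q : rat) (x : k) :
  n%:R * (q%:A * x) = (n%:R * q)%:A * x.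
Proof. by rewrite mulrA -[n%:R]scaler_nat -scalerAl mul1r scalerA. Qed.

Lemma natrS_eq0 n (x : k) : n.+1%:R * x = 0 -> x = 0.
Proof.
move/(congr1 (fun y => (n.+1%:R^-1 : rat)%:A * y)); rewrite mulr0 mulrCA.
by rewrite alg_mul_nat mulfV ?pnatr_eq0 // scale1r mul1r.
Qed.

Definition exp_coef n : k := (n`!%:R^-1 : rat)%:A.

Lemma exp_coef0 : exp_coef 0 = 1.
Proof. by rewrite /exp_coef invr1 scale1r. Qed.

Lemma exp_coefS n : n.+1%:R * exp_coef n.+1 = exp_coef n.
Proof.
rewrite -[X in _ * X]mulr1 alg_mul_nat mulr1 /exp_coef factS natrM invfM mulrA.
by rewrite mulfV ?pnatr_eq0 // mul1r.
Qed.

Context {I : Type}.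
Implicit Types P Q g h : series k I.
Notation SI := (series_summability k I).

Lemma euler_inj P Q : P [::] = Q [::] -> euler P = euler Q -> P = Q.
Proof.
move=> PQ0 PQ; apply/funext => -[//|x w].
have /eqP := congr1 (fun R : series k I => R (x :: w)) PQ.
by rewrite !eulerE -subr_eq0 -mulrBr => /eqP /natrS_eq0 /eqP; rewrite subr_eq0 => /eqP.
Qed.

Lemma order_power (c : nat -> k) P d : P [::] = 0 ->
  forall n, order_ge n (c n *: P ^+ (n + d)).
Proof.
move=> P0 n; apply: order_geZ; apply: (order_geW (n := n + d)).
  exact: leq_addr.
exact: order_geX.
Qed.

Lemma sexp_summable P : P [::] = 0 -> summable SI (fun n => exp_coef n *: P ^+ n).
Proof.
move=> P0; apply: order_ssum => n.
by have := @order_power exp_coef P 0 P0 n; rewrite addn0.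
Qed.

Lemma slog_summable g : g [::] = 1 -> summable SI
  (fun n => ((-1) ^+ n / n.+1%:R : rat)%:A *: (g - 1) ^+ n.+1).
Proof.
move=> g1; apply: order_ssum => n.
have g0 : (g - 1) [::] = 0 by rewrite !seriesE g1 subrr.
have := @order_power (fun n => ((-1) ^+ n / n.+1%:R : rat)%:A) _ 1 g0 n.
by rewrite addn1.
Qed.

Lemma sexpE P N w : P [::] = 0 -> (size w < N)%N ->
  sexp SI P w = \sum_(n < N) exp_coef n * (P ^+ n) w.
Proof.
move=> P0 wN; rewrite /sexp (@order_ssumE _ _ _ N) // => n.
by have := @order_power exp_coef P 0 P0 n; rewrite addn0.
Qed.

Lemma sexp_coef0 P : P [::] = 0 -> sexp SI P [::] = 1.
Proof.
move=> P0; rewrite (@sexpE P 1) // big_ord_recl big_ord0 addr0 exp_coef0.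
by rewrite expr0 mul1r.
Qed.

Lemma slog_coef0 g : g [::] = 1 -> slog SI g [::] = 0.
Proof.
move=> g1; have g0 : (g - 1) [::] = 0 by rewrite !seriesE g1 subrr.
rewrite /slog (series_ssumE (s := [::])) ?big_nil // => n _.
by rewrite seriesE exprS series_mul0 g0 mul0r mulr0.
Qed.

Lemma sexp0 : sexp SI 0 = 1.
Proof.
apply/funext => w; rewrite (@sexpE 0 (size w).+1) // big_ord_recl expr0.
rewrite exp_coef0 mul1r big1 ?addr0 // => i _.
by rewrite lift0 exprS mul0r seriesE mulr0.
Qed.

Lemma euler_sexp P : P [::] = 0 -> P * euler P = euler P * P ->
  euler (sexp SI P) = euler P * sexp SI P.
Proof.
move=> P0 cP; have sP := sexp_summable P0.
have [_ <-] := strong_op finitary_euler sP.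
have [_ <-] := strong_op (finitary_mulr (euler P)) sP.
rewrite ssum_natS => [|n]; last first.
  apply: euler_order.
  by have := @order_power exp_coef P 0 P0 n; rewrite addn0.
rewrite /= expr0 eulerZ euler1 scaler0 add0r.
congr (ssum SI _); apply/funext => n /=.
by rewrite eulerZ eulerX // scalerA mulrC exp_coefS -scalerAr.
Qed.

Lemma euler_slog g : g [::] = 1 -> g * euler g = euler g * g ->
  euler (slog SI g) * g = euler g.
Proof.
move=> g1 cg; have sg := slog_summable g1.
pose x : series k I := g - 1.
have x0 : x [::] = 0 by rewrite /x !seriesE g1 subrr.
have ex : euler x = euler g by rewrite eulerB euler1 subr0.
have cx : x * euler x = euler x * x.
  by rewrite ex mulrBl mulrBr mul1r mulr1 cg.
(* The geometric series for the inverse of [g = 1 + x]. *)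
pose G := ssum SI (fun n => (- x) ^+ n).
have Nx0 : (- x) [::] = 0 by rewrite seriesE x0 oppr0.
have oG n : order_ge n ((- x) ^+ n) by exact: order_geX.
have -> : euler (slog SI g) = euler g * G.
  have [_ <-] := strong_op finitary_euler sg.
  have [_ <-] := strong_op (finitary_mulr (euler g)) (order_ssum oG).
  congr (ssum SI _); apply/funext => n /=.
  rewrite -/x eulerZ eulerX // scalerA mulrC -[X in n.+1%:R * X]mulr1.
  rewrite alg_mul_nat mulr1 mulrCA mulfV ?pnatr_eq0 // mulr1 ex.
  rewrite -(scaleN1r x) exprZn -scalerAr; congr (_ *: _).
  by rewrite -[LHS]/(GRing.in_alg k _) rmorphXn rmorphN1.
have GE : G = 1 + (- x) * G.
  rewrite {1}/G ssum_natS //; congr (_ + _).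
  have [_ <-] := strong_op (finitary_mulr (- x)) (order_ssum oG).
  by congr (ssum SI _); apply/funext => n /=; rewrite exprS.
have GC : G * x = x * G.
  have [_ <-] := strong_op (finitary_mulr x) (order_ssum oG).
  have [_ /= <-] := strong_op (L := fun Q => Q * x) (finitary_mull x) (order_ssum oG).
  congr (ssum SI _); apply/funext => n /=.
  by apply/esym/commrX; rewrite /GRing.comm mulrN mulNr.
have gE : g = 1 + x by rewrite /x addrC subrK.
have Gg : G * g = 1.
  by rewrite [X in G * X]gE mulrDr mulr1 GC {1}GE mulNr subrK.
by rewrite -mulrA Gg mulr1.
Qed.

(** The difference [d = h - g] satisfies the same linear equation. In its lowest degree n the
    equation reads n d = 0, because [euler g] has no constant term. *)
Lemma euler_uniq g h : g [::] = 1 -> h [::] = 1 ->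
  euler h * g = euler g * h -> h = g.
Proof.
move=> g1 h1 E; apply/eqP; rewrite -subr_eq0; apply/eqP.
have d0 : (h - g) [::] = 0 by rewrite !seriesE g1 h1 subrr.
have dE : euler (h - g) * g = euler g * (h - g).
  by rewrite eulerB mulrBl mulrBr E.
move: (h - g) d0 dE => d d0 dE.
suff od n : order_ge n d by apply/funext => w; rewrite (od (size w).+1).
elim: n => [//|n IHn] w; rewrite ltnS leq_eqVlt => /orP[/eqP wn|]; last exact: IHn.
have /(congr1 (fun R : series k I => R w)) := dE.
rewrite !series_mulE big_ord_recr big_ord_recl /= take0 euler_coef0 mul0r.
rewrite add0r take_size drop_size g1 mulr1 [X in X + _ = _]big1 => [|i _]; last first.
  by rewrite eulerE IHn ?mulr0 ?mul0r // size_takel -?wn ?ltn_ord // ltnW.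
rewrite add0r big1 => [|i _]; last first.
  rewrite [d _]IHn ?mulr0 // size_drop /bump leq0n add1n -wn ltn_subrL.
  by rewrite (leq_ltn_trans _ (ltn_ord i)).
case: w wn => [//|x w] _; rewrite eulerE; exact: natrS_eq0.
Qed.

End ExpLogSeries.

(** * Identities between exp and log in one variable, and their transfer *)

Section OneVariable.
Context {k : comAlgType rat}.
Implicit Types P Q g : series k unit.
Notation SU := (series_summability k unit).

(** In one variable [P] commutes with [euler P], as [euler_sexp] demands; both sides then solve the
    same first-order equation, and [euler_uniq] identifies them. *)
Let sexpD1 P Q : P [::] = 0 -> Q [::] = 0 ->
  sexp SU (P + Q) = sexp SU P * sexp SU Q.
Proof.
move=> P0 Q0; have PQ0 : (P + Q) [::] = 0 by rewrite seriesE P0 Q0 addr0.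
have mC := @series_unit_mulC k.
have := (sexp_coef0 P0, sexp_coef0 Q0, sexp_coef0 PQ0).
have := (euler_sexp P0 (mC _ _), euler_sexp Q0 (mC _ _), euler_sexp PQ0 (mC _ _)).
move: (sexp SU P) (sexp SU Q) (sexp SU (P + Q)) => x y z [[Ex Ey] Ez] [[x1 y1] z1].
apply/esym/euler_uniq; rewrite ?series_mul0 ?x1 ?y1 ?z1 ?mulr1 //.
by rewrite eulerM Ex Ey Ez eulerD mulrA (mC x) -!mulrA -mulrDl mulrA (mC x)
  (mC z) (mC y x) !mulrA.
Qed.

Let sexpN1 P : P [::] = 0 -> sexp SU P * sexp SU (- P) = 1.
Proof. by move=> P0; rewrite -sexpD1 ?subrr ?sexp0 // seriesE P0 oppr0. Qed.

Let sexp_slog1 g : g [::] = 1 -> sexp SU (slog SU g) = g.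
Proof.
move=> g1; have L0 := slog_coef0 g1.
apply: euler_uniq; rewrite ?sexp_coef0 // euler_sexp //; last first.
  exact: series_unit_mulC.
rewrite -mulrA (series_unit_mulC _ g) mulrA euler_slog //.
exact: series_unit_mulC.
Qed.

Let slog_sexp1 P : P [::] = 0 -> slog SU (sexp SU P) = P.
Proof.
move=> P0; have g1 := sexp_coef0 P0; have L0 := slog_coef0 g1.
apply: euler_inj; first by rewrite L0 P0.
have := euler_slog g1 (series_unit_mulC _ _).
rewrite euler_sexp //; last exact: series_unit_mulC.
move/(congr1 (fun Q => Q * sexp SU (- P))).
by rewrite -!mulrA sexpN1 // !mulr1.
Qed.

Section Transfer.
Context {A : algType k} (S : summability A).

Lemma umorph_sexp I (phi : series k I -> A) (P : series k I) : unital_morphism S phi ->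
  P [::] = 0 -> phi (sexp (series_summability k I) P) = sexp S (phi P).
Proof.
move=> phiP P0; have [_ <-] := umorph_ssum phiP (sexp_summable P0).
congr (ssum S _); apply/funext => n /=.
by rewrite (umorphZ phiP) (umorphX phiP).
Qed.

Lemma umorph_slog I (phi : series k I -> A) (g : series k I) : unital_morphism S phi ->
  g [::] = 1 -> phi (slog (series_summability k I) g) = slog S (phi g).
Proof.
move=> phiP g1; have [_ <-] := umorph_ssum phiP (slog_summable g1).
congr (ssum S _); apply/funext => n /=.
by rewrite (umorphZ phiP) (umorphX phiP) (umorphB phiP) (umorph1 phiP).
Qed.

Let X : series k unit := series_var k tt.

Let X0 : X [::] = 0. Proof. by rewrite /X /series_var asboolF. Qed.

Variable phi : series k unit -> A.
Hypothesis phiP : unital_morphism S phi.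

Lemma umorph_sexp_slog : sexp S (slog S (1 + phi X)) = 1 + phi X.
Proof.
have g1 : (1 + X) [::] = 1 by rewrite !seriesE X0 addr0.
have phig : phi (1 + X) = 1 + phi X by rewrite (umorphD phiP) (umorph1 phiP).
rewrite -phig -(umorph_slog phiP) // -(umorph_sexp phiP) ?sexp_slog1 //.
exact: slog_coef0.
Qed.

Lemma umorph_slog_sexp : slog S (sexp S (phi X)) = phi X.
Proof.
by rewrite -(umorph_sexp phiP) // -(umorph_slog phiP) ?slog_sexp1 ?sexp_coef0.
Qed.

Lemma umorph_sexp_scaleD a b :
  sexp S ((a + b) *: phi X) = sexp S (a *: phi X) * sexp S (b *: phi X).
Proof.
have cX0 c : (c *: X) [::] = 0 by rewrite seriesE X0 mulr0.
have E c : phi (sexp SU (c *: X)) = sexp S (c *: phi X).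
  by rewrite -(umorphZ phiP); apply: umorph_sexp.
rewrite -(E (a + b)) -(E a) -(E b) -(umorphM phiP) -(sexpD1 (cX0 a) (cX0 b)).
by rewrite scalerDl.
Qed.

End Transfer.
End OneVariable.

Section ExpLogSeries.
Context {k : comAlgType rat} {I : Type}.
Implicit Types P g : series k I.
Notation SI := (series_summability k I).

Let one_var P : P [::] = 0 ->
  exists2 phi : series k unit -> series k I,
    unital_morphism SI phi & phi (series_var k tt) = P.
Proof.
move=> P0; exists (series_ev (fun=> P)).
  by apply: series_ev_morphism => // w; apply: finite_finset.
by apply: series_ev_var => // w; apply: finite_finset.
Qed.

Lemma sexp_slog g : g [::] = 1 -> sexp SI (slog SI g) = g.
Proof.
move=> g1; have [|phi phiP phiX] := one_var (P := g - 1).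
  by rewrite !seriesE g1 subrr.
have gE : 1 + (g - 1) = g by rewrite addrCA subrr addr0.
by have := umorph_sexp_slog phiP; rewrite phiX gE.
Qed.

Lemma slog_sexp P : P [::] = 0 -> slog SI (sexp SI P) = P.
Proof. by case/one_var=> phi phiP <-; apply: umorph_slog_sexp. Qed.

Lemma sexp_scaleD a b P : P [::] = 0 ->
  sexp SI ((a + b) *: P) = sexp SI (a *: P) * sexp SI (b *: P).
Proof. by case/one_var=> phi phiP <-; apply: umorph_sexp_scaleD. Qed.

Lemma sexpN P : P [::] = 0 -> sexp SI P * sexp SI (- P) = 1.
Proof.
move=> P0; have := sexp_scaleD 1 (-1) P0.
by rewrite subrr scale0r sexp0 scale1r scaleN1r.
Qed.

Lemma sexp_scale_nat n P : P [::] = 0 -> sexp SI (n%:R *: P) = sexp SI P ^+ n.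
Proof.
move=> P0; elim: n => [|n IHn]; first by rewrite scale0r sexp0 expr0.
by rewrite -natr1 sexp_scaleD // IHn scale1r exprSr.
Qed.

End ExpLogSeries.

(** * The adjoint action of series *)

Section AdjointAction.
Context {k : comNzRingType} {I : Type}.
Implicit Types (P Q T : series k I) (F G : I -> series k I).
Notation SI := (series_summability k I).

(** Left division by a letter: [P] is its constant term plus the sum over i of [X_i * shift i P]. *)
Definition shift i P : series k I := fun w => P (i :: w).

Definition deg1 P : series k I := fun w => if w is [:: _] then P w else 0.

(* The sum of the brackets [X_i, F i], coefficient by coefficient. *)
Definition adsum F : series k I :=
  fun w => if w is x :: w' then F x w' - F (last x w') (belast x w') else 0.

Lemma shiftM i P Q : shift i (P * Q) = P [::] *: shift i Q + shift i P * Q.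
Proof.
apply/funext => w; rewrite !seriesE /shift !series_mulE /= big_ord_recl /=.
by [].
Qed.

Lemma deg1M P Q : deg1 (P * Q) = P [::] *: deg1 Q + Q [::] *: deg1 P.
Proof.
apply/funext => -[|x [|y w]]; rewrite !seriesE /= ?mulr0 ?addr0 //.
by rewrite series_mulE !big_ord_recl big_ord0 /= addr0 mulrC [P [:: x] * _]mulrC
   [_ * P [::]]mulrC.
Qed.

Lemma series_varM i Q : series_var k i * Q =
  fun w => if w is x :: w' then `[< x = i >]%:R * Q w' else 0.
Proof.
apply/funext => -[|x w]; first by rewrite series_mul0 /series_var asboolF ?mul0r.
rewrite series_mulE !big_ord_recl /= /series_var asboolF // mul0r add0r.
rewrite take0 drop0 big1 ?addr0 => [|j _]; last first.
  rewrite asboolF ?mul0r //=; case: w j => [[]//|y w] j; by case.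
by congr (_%:R * _); apply: congr1; apply: asbool_equiv_eq; split=> [[]|->].
Qed.

Lemma mul_series_var Q i : Q * series_var k i =
  fun w => if w is x :: w' then `[< last x w' = i >]%:R * Q (belast x w') else 0.
Proof.
apply/funext => -[|x w]; first by rewrite series_mul0 /series_var asboolF ?mulr0.
rewrite lastI series_mulE size_rcons !big_ord_recr /=.
rewrite -[in X in _ + X](size_rcons (belast x w) (last x w)) take_size drop_size.
have -> : series_var k i [::] = 0 by rewrite /series_var asboolF.
rewrite mulr0 addr0.
rewrite -cats1 take_size_cat // drop_size_cat // big1 ?add0r => [|j _].
  rewrite mulrC; congr (_%:R * _); apply: congr1.
  by apply: asbool_equiv_eq; split=> [[]|->].
rewrite drop_cat ltn_ord /series_var asboolF ?mulr0 //.
move/(congr1 size); rewrite size_cat size_drop /= addn1 => -[] /eqP.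
by rewrite subn_eq0 leqNgt ltn_ord.
Qed.

Lemma adsum_ssum F :
  summable SI (fun i => bracket (series_var k i) (F i)) /\
  ssum SI (fun i => bracket (series_var k i) (F i)) = adsum F.
Proof.
(* The coefficient of [[X_i, F i]] at [w] can be nonzero only if i is the first or the last letter
   of [w]. *)
pose s (w : seq I) : seq {classic I} :=
  if w is x :: w' then undup [:: x : {classic I}; last x w' : {classic I}] else [::].
have us w : uniq (s w) by case: w => [//|x w]; apply: undup_uniq.
have brE i w : bracket (series_var k i) (F i) w = if w is x :: w'
    then `[< x = i >]%:R * F i w' - `[< last x w' = i >]%:R * F i (belast x w')
    else 0.
  rewrite /bracket !seriesE series_varM mul_series_var.
  by case: w => [|//]; rewrite subr0.
have s0 w i : i \notin s w -> bracket (series_var k i) (F i) w = 0.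
  rewrite brE; case: w => [//|x w]; rewrite mem_undup !inE negb_or.
  case/andP=> /eqP/nesym xi /eqP/nesym li.
  by rewrite !asboolF // !mul0r subr0.
split=> [w|]; first by apply/finite_supportE; exists (s w) => //; apply: s0.
apply/funext => w; rewrite (series_ssumE (us w)); last exact: s0.
under eq_bigr do rewrite brE.
case: w => [|x w]; first by rewrite big_nil.
have pick (y : {classic I}) (H : I -> k) : y \in s (x :: w) ->
    \sum_(i <- s (x :: w)) `[< y = i :> I >]%:R * H i = H y.
  move=> ys; rewrite (bigD1_seq y ys (us _)) [LHS]/= asboolT // mul1r big1 ?addr0 // => i.
  by move=> /eqP/nesym yi; rewrite asboolF ?mul0r.
rewrite sumrB (pick x (fun i => F i w)) ?mem_undup ?inE ?eqxx //.
by rewrite (pick (last x w) (fun i => F i (belast x w))) // mem_undup !inE eqxx orbT.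
Qed.

(** Expands [P] by its left quotients [shift i P] and brackets the action of each with [X_i]; the
    term [s *: deg1 P] collects the brackets of the letters with multiples of d. A bracket with a
    letter consults a word shorter by one, so [size w] is enough fuel for the coefficient at [w]. *)
Fixpoint adact_rec n P T (s : k) : series k I :=
  P [::] *: T + s *: deg1 P
  + (if n is n'.+1 then adsum (fun i => adact_rec n' (shift i P) T s) else 0).

(* The action of P on the semidirect extension of series by a derivation d with
   [X_i, d] = X_i: the letters act by brackets, the pair (T, s) stands for
   T + s d, and [adact P T s] is the result of acting by P, dropping the d-part.
   In particular [adact P 0 1] is Dynkin's map to right-normed brackets. *)
Definition adact P T s : series k I := fun w => adact_rec (size w) P T s w.

Lemma adactE P T s : adact P T s =
  P [::] *: T + s *: deg1 P + adsum (fun i => adact (shift i P) T s).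
Proof.
apply/funext => -[|x w] //=.
by rewrite /adact /= !seriesE /= /adact size_belast.
Qed.

Lemma finitary_shift i w : finitary (fun P => shift i P w).
Proof. exact: finitary_coef. Qed.

Lemma finitary_adact T s w : finitary (fun P => adact P T s w).
Proof.
have f1 u : finitary (fun P => (P [::] *: T + s *: deg1 P) u).
  apply: finitaryD.
    have := finitaryZ (T u) (@finitary_coef k I [::]); congr finitary.
    by apply/funext => P; rewrite seriesE mulrC.
  apply: finitaryZ; case: u => [|x [|y u]] /=; [exact: finitary0| |exact: finitary0].
  exact: finitary_coef.
have E u : (fun P => adact P T s u) = (fun P => (P [::] *: T + s *: deg1 P) u
    + adsum (fun i => adact (shift i P) T s) u).
  by apply/funext => P; rewrite adactE.
have [n wn] : exists n, (size w <= n)%N by exists (size w).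
elim: n w wn => [|n IHn] [|x w] wn //; rewrite E; apply: finitaryD => //=.
- exact: finitary0.
- exact: finitary0.
apply: finitaryD.
  exact: (finitary_comp (L := shift x)) (finitary_shift x) (IHn _ wn).
apply: finitaryN.
apply: (finitary_comp (L := shift (last x w))) (finitary_shift _) (IHn _ _).
by rewrite size_belast.
Qed.

Lemma adact_linear c P Q T s :
  adact (c *: P + Q) T s = c *: adact P T s + adact Q T s.
Proof. exact: (op_linear (L := fun P => adact P T s)) (finitary_adact T s). Qed.

Lemma adactD P Q T s : adact (P + Q) T s = adact P T s + adact Q T s.
Proof. by have := adact_linear 1 P Q T s; rewrite !scale1r. Qed.

Lemma adact0 T s : adact 0 T s = 0.
Proof. by apply: (@addrI _ (adact 0 T s)); rewrite -adactD !addr0. Qed.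

Lemma adactZ c P T s : adact (c *: P) T s = c *: adact P T s.
Proof. by have := adact_linear c P 0 T s; rewrite adact0 !addr0. Qed.

Lemma adactB P Q T s : adact (P - Q) T s = adact P T s - adact Q T s.
Proof. by rewrite -scaleN1r addrC adact_linear scaleN1r addrC. Qed.

Lemma adact1 T s : adact 1 T s = T.
Proof.
rewrite adactE seriesE scale1r; apply/funext => w; rewrite !seriesE.
have sh i : shift i 1 = 0 by apply/funext.
rewrite [deg1 _ w](_ : _ = 0); last by case: w => [|x [|]].
by rewrite mulr0 addr0; case: w => [|x w] /=; rewrite ?sh ?adact0 ?subrr addr0.
Qed.

(** Evaluating a bracket with a letter strips that letter from the word and hands it to [shift], so
    only letters of [w] are consulted. This allows an infinite ordered product to be replaced by a
    finite one at each word. *)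
Lemma adact_local P Q T s (w : seq {classic I}) :
  (forall u : seq {classic I}, (size u <= size w)%N -> {subset u <= w} -> P u = Q u) ->
  adact P T s w = adact Q T s w.
Proof.
have [n wn] : exists n, (size w <= n)%N by exists (size w).
elim: n w wn P Q => [|n IHn] [|x w] wn P Q PQ //.
- by rewrite !adactE !seriesE /= PQ.
- by rewrite !adactE !seriesE /= PQ.
rewrite !adactE !seriesE PQ //; congr (_ + _ * _ + _).
  case: w PQ {wn} => [|//] PQ /=; exact: PQ.
congr (_ - _); apply: IHn; rewrite ?size_belast // => u uw us; apply: PQ => // y.
  by rewrite !inE => /orP[->//|/us->]; rewrite orbT.
rewrite inE => /orP[/eqP->|/us]; first exact: mem_last.
exact: mem_belast.
Qed.

Lemma adact_order n P T s : order_ge n P -> order_ge n (adact P T s).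
Proof.
move=> nP w wn; rewrite (@adact_local _ 0) ?adact0 // => u uw _.
by rewrite nP //; apply: leq_ltn_trans wn.
Qed.

(** [Q] sends the pair [(T, s)] to [(adact Q T s, s * Q [::])], and products act by composition. *)
Lemma adactM P Q T s : adact (P * Q) T s = adact P (adact Q T s) (s * Q [::]).
Proof.
apply/funext => w; have [n wn] : exists n, (size w <= n)%N by exists (size w).
elim: n w wn P => [|n IHn] w wn P.
all: have QE : adact Q T s w = Q [::] * T w + s * deg1 Q w
    + adsum (fun i => adact (shift i Q) T s) w by rewrite adactE !seriesE.
all: have -> : adact (P * Q) T s w = P [::] * Q [::] * T w
    + s * (P [::] * deg1 Q w + Q [::] * deg1 P w)
    + adsum (fun i => adact (shift i (P * Q)) T s) w
  by rewrite adactE !seriesE series_mul0 deg1M !seriesE.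
all: have -> : adact P (adact Q T s) (s * Q [::]) w =
    P [::] * (Q [::] * T w + s * deg1 Q w + adsum (fun i => adact (shift i Q) T s) w)
    + s * Q [::] * deg1 P w
    + adsum (fun i => adact (shift i P) (adact Q T s) (s * Q [::])) w
  by rewrite adactE !seriesE QE.
all: clear QE.
  by case: w wn => // _ /=; ring.
case: w wn => [_|x w wn]; first by rewrite /=; ring.
rewrite [adsum _ _]/= [X in _ = _ + X]/= [X in _ = _ * (_ + X) + _ + _]/=.
rewrite !shiftM !adact_linear !seriesE !IHn ?size_belast //.
by ring.
Qed.

Lemma adact_var i T s :
  adact (series_var k i) T s = bracket (series_var k i) T + s *: series_var k i.
Proof.
have X0 : series_var k i [::] = 0 by rewrite /series_var asboolF.
rewrite adactE X0 scale0r add0r addrC; congr (_ + _ *: _); last first.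
  apply/funext => -[|x [|y w]] /=; rewrite ?X0 //.
  by rewrite /series_var asboolF.
have -> : (fun j => adact (shift j (series_var k i)) T s)
    = (fun j => `[< j = i >]%:R *: T).
  apply/funext => j.
  have -> : shift j (series_var k i) = `[< j = i >]%:R *: 1.
    apply/funext => w; rewrite seriesE /shift /series_var.
    have [->|ji] := EM (j = i).
      rewrite (asboolT (erefl i)) mul1r; case: w => [|x w]; first by rewrite asboolT.
      by rewrite asboolF.
    by rewrite [`[< j = i >]]asboolF // mul0r asboolF // => -[].
  by rewrite adactZ adact1.
have [_ <-] := adsum_ssum (fun j => `[< j = i >]%:R *: T).
apply/funext => w; rewrite (series_ssumE (s := [:: i : {classic I}])) //.
  by rewrite big_seq1 asboolT // scale1r.
move=> j; rewrite inE => /eqP ji.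
by rewrite asboolF // scale0r /bracket mulr0 mul0r subrr.
Qed.

Lemma bracket_coef0 P Q : P [::] = 0 -> Q [::] = 0 -> bracket P Q [::] = 0.
Proof. by move=> P0 Q0; rewrite /bracket !seriesE !series_mul0 P0 Q0 !mulr0 subrr. Qed.

(* Since [P, d] = euler P, these are the P acting as the bracket with P. *)
Definition ad_primitive : set (series k I) :=
  [set P : series k I | P [::] = 0 /\
    forall T s, adact P T s = bracket P T + s *: euler P].

Lemma ad_primitive_ssum J (P : J -> series k I) :
  (forall j, ad_primitive (P j)) -> summable SI P -> ad_primitive (ssum SI P).
Proof.
move=> primP sP; split.
  by rewrite (series_ssumE (s := [::])) ?big_nil // => j _; case: (primP j).
move=> T s; apply/funext => w; apply/eqP; rewrite -subr_eq0; apply/eqP.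
have fin : finitary (fun Q => adact Q T s w - (bracket Q T + s *: euler Q) w).
  apply: finitaryD; first exact: finitary_adact.
  apply: finitaryN; apply: finitaryD; last exact/finitaryZ/finitary_euler.
  by apply: finitaryD; [exact: finitary_mull|exact/finitaryN/finitary_mulr].
have [u [_ _ ->]] := finitary_ssum fin sP.
by rewrite big1 // => j _; case: (primP j) => _ ->; rewrite subrr.
Qed.

Lemma ad_primitive_subalgebra :
  is_summability_subalgebra SI bracket ad_primitive.
Proof.
split=> [|c P Q [P0 PE] [Q0 QE]|P Q [P0 PE] [Q0 QE]|]; last exact: ad_primitive_ssum.
- split=> // T s; rewrite adact0 /bracket mul0r mulr0 subrr add0r.
  by apply/funext => w; rewrite !seriesE eulerE !mulr0.
- split=> [|T s]; first by rewrite !seriesE P0 Q0 mulr0 addr0.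
  rewrite adact_linear PE QE /bracket eulerD eulerZ mulrDl mulrDr.
  rewrite -scalerAl -scalerAr; apply/funext => w; rewrite !seriesE; ring.
split=> [|T s]; first exact: bracket_coef0.
(* A commutator acts by the commutator of the actions, so what remains is the Jacobi identity
   together with the Leibniz rule for [euler]. *)
rewrite adactB !adactM P0 Q0 !mulr0 !PE !QE !scale0r !addr0.
rewrite eulerB !eulerM /bracket.
rewrite !(mulrDl, mulrDr, mulrN, mulNr) -!scalerAl -!scalerAr !mulrA.
apply/funext => w; rewrite !seriesE; ring.
Qed.

Lemma lie_series_ad_primitive : @lie_series k I `<=` ad_primitive.
Proof.
move=> P; apply; first exact: ad_primitive_subalgebra.
move=> i; split=> [|T s]; first by rewrite /series_var asboolF.
rewrite adact_var; congr (_ + _ *: _); apply/funext => w.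
rewrite eulerE /series_var; have [->|wi] := EM (w = [:: i]).
  by rewrite asboolT // mulr1.
by rewrite asboolF // mulr0.
Qed.

Lemma lie_series_subalgebra : is_summability_subalgebra SI bracket (@lie_series k I).
Proof.
split.
- by move=> L LP _; apply: ssub_zero LP.
- by move=> c P Q PL QL L LP Lv; apply: (ssub_linear LP); [apply: PL|apply: QL].
- by move=> P Q PL QL L LP Lv; apply: (ssub_mul LP); [apply: PL|apply: QL].
- by move=> J P PL sP L LP Lv; apply: (ssub_ssum LP) => // j; apply: PL.
Qed.

Lemma lie_series_var i : lie_series (series_var k i : series k I).
Proof. by move=> L _; apply. Qed.

Lemma lie_series_coef0 P : lie_series P -> P [::] = 0.
Proof. by move/lie_series_ad_primitive => -[]. Qed.

Lemma lie_series_scale c P : lie_series P -> lie_series (c *: P).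
Proof.
move=> PL; rewrite -[_ *: _]addr0.
exact: (ssub_linear lie_series_subalgebra) PL (ssub_zero lie_series_subalgebra).
Qed.

(* These are the g acting as conjugation by g: as d g = g d - euler g, the
   relation is (adact g T s + s d) g = g (T + s d). *)
Definition ad_grouplike : set (series k I) :=
  [set g : series k I | g [::] = 1 /\
    forall T s, adact g T s * g = g * T + s *: euler g].

Lemma ad_grouplike1 : ad_grouplike 1.
Proof.
by split=> // T s; rewrite adact1 euler1 scaler0 addr0 mulr1 mul1r.
Qed.

Lemma ad_grouplikeM g h : ad_grouplike g -> ad_grouplike h -> ad_grouplike (g * h).
Proof.
move=> [g1 gE] [h1 hE]; split=> [|T s]; first by rewrite series_mul0 g1 h1 mulr1.
rewrite adactM h1 mulr1 mulrA gE mulrDl -mulrA hE eulerM mulrDr.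
rewrite -scalerAr -scalerAl scalerDr mulrA -!addrA; congr (_ + _).
exact: addrC.
Qed.

Lemma ad_grouplikeX g n : ad_grouplike g -> ad_grouplike (g ^+ n).
Proof.
move=> gG; elim: n => [|n IHn]; first by rewrite expr0; apply: ad_grouplike1.
by rewrite exprS; apply: ad_grouplikeM.
Qed.

Lemma ad_grouplike_prod (J : Type) (s : seq J) (g : J -> series k I) :
  (forall j, ad_grouplike (g j)) -> ad_grouplike (\prod_(j <- s) g j).
Proof.
move=> gG; elim: s => [|j s IHs]; first by rewrite big_nil; apply: ad_grouplike1.
by rewrite big_cons; apply: ad_grouplikeM.
Qed.

(** The relation at [w] involves [g] only at words over the letters of [w] that are no longer than
    [w], so the comparison series [h] may depend on [w]. *)
Lemma ad_grouplike_local (g : series k I) :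
  (forall w : seq {classic I}, exists2 h, ad_grouplike h &
    forall u : seq {classic I}, (size u <= size w)%N -> {subset u <= w} -> g u = h u) ->
  ad_grouplike g.
Proof.
move=> gh; split=> [|T s].
  by have [h [h1 _] ->] := gh [::].
apply/funext => w; have [h [h1 hE] ghE] := gh w.
have gw : g w = h w by apply: ghE.
have := congr1 (fun R : series k I => R w) (hE T s).
rewrite !seriesE !eulerE gw !series_mulE.
have sub_take i (u : seq {classic I}) : {subset take i u <= u} by move=> x /mem_take.
have sub_drop i (u : seq {classic I}) : {subset drop i u <= u} by move=> x /mem_drop.
have st i : (size (take i w) <= size w)%N by rewrite size_take_min geq_minr.
have sd i : (size (drop i w) <= size w)%N by rewrite size_drop leq_subr.
under eq_bigr => i _.
  rewrite -(@adact_local g h); last first.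
    move=> u uw us; apply: ghE; first exact: leq_trans uw (st i).
    by move=> x /us; apply: sub_take.
  rewrite -(ghE (drop i w)); [|exact: sd|exact: sub_drop].
  over.
move=> ->; congr (_ + _); apply: eq_bigr => i _.
by rewrite ghE.
Qed.

End AdjointAction.

(** * Lie series and group series *)

Section BigLemmas.
Context {V : zmodType}.

(** Regroups a product of two truncated series by total degree; the hypothesis discards the far
    corner of the square. *)
Lemma big_triangle (f : nat -> nat -> V) N :
  (forall n m, (N <= n + m)%N -> f n m = 0) ->
  \sum_(n < N) \sum_(m < N) f n m = \sum_(M < N) \sum_(i < M.+1) f i (M - i)%N.
Proof.
move=> f0; transitivity (\sum_(n < N) \sum_(m < N - n) f n m).
  apply: eq_bigr => n _; rewrite -!(big_mkord xpredT (f n)).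
  rewrite (big_cat_nat (n := (N - n)%N)) //= ?leq_subr // [X in _ + X]big_nat_cond.
  by rewrite [X in _ + X]big1 ?addr0 // => m /andP[/andP[mN _] _]; rewrite f0 // -leq_subLR.
elim: N {f0} => [|N IHN]; first by rewrite !big_ord0.
rewrite big_ord_recr /= subSnn big_ord_recr big_ord0 /= add0r.
rewrite [RHS]big_ord_recr /= -IHN [X in _ = _ + X]big_ord_recr /= subnn addrA.
congr (_ + _); rewrite -big_split /=; apply: eq_bigr => n _.
by rewrite subSn ?big_ord_recr // ltnW.
Qed.

(** Pascal's rule, in the form needed for the inductive step of a binomial expansion. *)
Lemma big_pascal (f : nat -> nat -> V) M :
  \sum_(i < M.+2) f i (M.+1 - i)%N *+ 'C(M.+1, i) =
  \sum_(i < M.+1) (f i.+1 (M - i)%N + f i (M - i).+1) *+ 'C(M, i).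
Proof.
transitivity (f 0%N M.+1 + \sum_(i < M.+1) f i.+1 (M - i)%N *+ 'C(M, i.+1)
    + \sum_(i < M.+1) f i.+1 (M - i)%N *+ 'C(M, i)).
  rewrite big_ord_recl bin0 subn0 -addrA; congr (_ + _).
  rewrite -big_split /=; apply: eq_bigr => i _.
  by rewrite /bump leq0n add1n subSS binS mulrnDr.
under [RHS]eq_bigr do rewrite mulrnDl.
rewrite [RHS]big_split /= [RHS]addrC; congr (_ + _).
rewrite big_ord_recr /= bin_small // mulr0n addr0.
rewrite [RHS]big_ord_recl /= bin0 subn0; congr (_ + _).
by apply: eq_bigr => i _; rewrite /bump leq0n add1n subnSK.
Qed.

End BigLemmas.

(** The coefficients lie in a module, so they are recovered by inverting the Vandermonde matrix at
    the nodes 0, ..., N - 1. *)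
Lemma rat_poly_eq0 {V : lmodType rat} N (q : nat -> V) :
  (forall t : nat, \sum_(M < N) (t%:R ^+ M : rat) *: q M = 0) ->
  forall M, (M < N)%N -> q M = 0.
Proof.
move=> q0 M MN; pose a : 'rV[rat]_N := \row_j (j : nat)%:R.
pose W := Vandermonde N a.
have Wu : W \in unitmx.
  rewrite unitmxE det_Vandermonde unitfE; apply/prodf_neq0 => i _.
  apply/prodf_neq0 => j ij; rewrite !mxE subr_eq0 eqr_nat.
  by rewrite neq_ltn ij orbT.
have <- : \sum_(i < N) (1%:M : 'M[rat]_N) i (Ordinal MN) *: q i = q M.
  rewrite (bigD1 (Ordinal MN)) //= mxE eqxx scale1r big1 ?addr0 // => i iM.
  by rewrite mxE (negPf iM) scale0r.
rewrite -(mulmxV Wu).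
under eq_bigr do rewrite mxE scaler_suml.
rewrite exchange_big big1 //= => j _.
have := congr1 (fun v => invmx W j (Ordinal MN) *: v) (q0 j).
rewrite scaler0 scaler_sumr => E; rewrite -[RHS]E; apply: eq_bigr => i _.
by rewrite !mxE scalerA mulrC.
Qed.

(** * Dynkin's map, and exp and log between the two adjoint relations *)

Section Dynkin.
Context {k : comAlgType rat} {I : Type}.
Implicit Types (P Q T g : series k I).
Notation SI := (series_summability k I).

Definition grade n P : series k I := fun w => if size w == n then P w else 0.

Lemma lie_series_adsum (F : I -> series k I) :
  (forall i, lie_series (F i)) -> lie_series (adsum F).
Proof.
move=> FL; have [sF <-] := adsum_ssum F.
apply: (ssub_ssum lie_series_subalgebra) sF => i.
by apply: (ssub_mul lie_series_subalgebra) => //; apply: lie_series_var.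
Qed.

Lemma deg1_ssum Q : summable SI (fun i => Q [:: i] *: series_var k i) /\
  ssum SI (fun i => Q [:: i] *: series_var k i) = deg1 Q.
Proof.
have s0 w : exists2 s : seq {classic I}, uniq s &
    (forall i, i \notin s -> (Q [:: i] *: series_var k i : series k I) w = 0) /\
    \sum_(i <- s) (Q [:: i] *: series_var k i : series k I) w = deg1 Q w.
  case: w => [|x [|y w]].
  - exists [::] => //; split; last by rewrite big_nil.
    by move=> i _; rewrite seriesE /series_var asboolF ?mulr0.
  - exists [:: x : {classic I}] => //; split.
      move=> i; rewrite inE seriesE /series_var => /eqP ix.
      by rewrite asboolF ?mulr0 // => -[/esym].
    by rewrite big_seq1 seriesE /series_var asboolT // mulr1.
  - exists [::] => //; split; last by rewrite big_nil.
    by move=> i _; rewrite seriesE /series_var asboolF ?mulr0.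
split=> [w|]; first by have [s us [s1 _]] := s0 w; apply/finite_supportE; exists s.
apply/funext => w; have [s us [s1 <-]] := s0 w.
by rewrite (series_ssumE us).
Qed.

Lemma lie_series_deg1 Q : lie_series (deg1 Q).
Proof.
have [sQ <-] := deg1_ssum Q.
apply: (ssub_ssum lie_series_subalgebra) sQ => i.
by apply: lie_series_scale; apply: lie_series_var.
Qed.

Lemma grade0_adact Q : grade 0 (adact Q 0 1) = 0.
Proof.
apply/funext => -[|x w] //; rewrite /grade /= adactE !seriesE /=.
by rewrite !mulr0 !addr0.
Qed.

Lemma gradeS_adact n Q : grade n.+1 (adact Q 0 1) =
  (n == 0%N)%:R *: deg1 Q + adsum (fun i => grade n (adact (shift i Q) 0 1)).
Proof.
apply/funext => w; rewrite /grade; case: ifP => wn; last first.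
  rewrite !seriesE; case: w wn => [|x w] /= wn; first by rewrite mulr0 addr0.
  rewrite size_belast; rewrite eqSS in wn; rewrite wn subrr addr0.
  by case: w wn => [|y w]; rewrite ?mulr0 //= eq_sym => ->; rewrite mul0r.
rewrite adactE !seriesE mulr0 add0r mul1r; case: w wn => [//|x w] wn.
rewrite [adsum _ _]/= [X in _ = _ + X]/= size_belast; rewrite /= eqSS in wn.
rewrite wn; congr (_ + _); case: w wn => [|y w]; rewrite ?mulr0 //= eq_sym => ->.
by rewrite mul1r.
Qed.

(** By [gradeS_adact], each degree is a summable sum of brackets of letters with components of the
    previous degree, whatever [Q] is. *)
Lemma lie_series_Dynkin n Q : lie_series (grade n (adact Q 0 1)).
Proof.
elim: n Q => [|n IHn] Q.
  by rewrite grade0_adact; apply: ssub_zero lie_series_subalgebra.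
rewrite gradeS_adact.
apply: (ssub_linear lie_series_subalgebra); first exact: lie_series_deg1.
exact: lie_series_adsum.
Qed.

(** Dynkin-Specht-Wever: at [T = 0], [s = 1] the relation says that Dynkin's map sends [P] to
    [euler P], so the degree n part of [P] is 1/n times a Lie series. *)
Lemma ad_primitive_lie P : ad_primitive P -> lie_series P.
Proof.
move=> [P0 PE].
have DP : adact P 0 1 = euler P.
  by rewrite PE /bracket mul0r mulr0 subrr add0r scale1r.
(* For n = 0 the inverse is 0 by convention, which is right since [P] has no constant term. *)
pose F n := (n%:R^-1 : rat)%:A *: grade n (euler P).
have oF n : order_ge n (F n).
  by move=> w wn; rewrite /F seriesE /grade (ltn_eqF wn) mulr0.
have -> : P = ssum SI F.
  apply/funext => w; rewrite (order_ssumE oF (ltnSn (size w))).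
  rewrite big_ord_recr big1 => [|i _]; last first.
    by rewrite /F seriesE /grade (gtn_eqF (ltn_ord i)) mulr0.
  rewrite /= add0r /F seriesE /grade eqxx eulerE mulrCA alg_mul_nat.
  case: w => [|x w]; first by rewrite P0 mulr0.
  by rewrite mulfV ?pnatr_eq0 // scale1r mul1r.
apply: (ssub_ssum lie_series_subalgebra); last exact: order_ssum.
move=> n; apply: lie_series_scale; rewrite -DP; exact: lie_series_Dynkin.
Qed.

(** With the factor [exp_coef M], this is the part of degree M in [P] of
    [adact (sexp SI P) T s * sexp SI P]. *)
Definition adact_binom P T (s : k) M : series k I :=
  \sum_(i < M.+1) adact (P ^+ i) T s * P ^+ (M - i) *+ 'C(M, i).

Section Exponential.
Variables (P T : series k I) (s : k).
Hypothesis P0 : P [::] = 0.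

(** [[P, -]] plus right multiplication by [P] is left multiplication by [P], and the first two
    commute, so the binomial sum collapses to left multiplication by [P ^+ M]. The [euler] terms
    enter through [i = 0] only, as a positive power of [P] leaves no multiple of d. *)
Lemma adact_binom_primitive M :
  ad_primitive P -> adact_binom P T s M = P ^+ M * T + s *: euler (P ^+ M).
Proof.
pose f i j := adact (P ^+ i) T s * P ^+ j.
move=> [_ PE]; elim: M => [|M IHM].
  by rewrite /adact_binom big_ord_recl big_ord0 expr0 adact1 euler1 scaler0
     !addr0 mul1r mulr1.
have fS i j : f i.+1 j + f i j.+1
    = P * f i j + (s * (i == 0%N)%:R) *: (euler P * P ^+ j).
  rewrite /f exprS adactM PE /bracket.
  have -> : (P ^+ i) [::] = (i == 0%N)%:R.
    by case: i => [|i]; rewrite ?expr0 // exprS series_mul0 P0 mul0r.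
  rewrite mulrDl mulrBl -scalerAl exprS !mulrA addrAC subrK.
  by rewrite addrC.
rewrite /adact_binom (big_pascal f).
under eq_bigr do rewrite fS mulrnDl -mulrnAr.
rewrite big_split /= -mulr_sumr -/(adact_binom P T s M) IHM.
rewrite big_ord_recl /= bin0 mulr1 subn0 big1 ?addr0 => [|i _]; last first.
  by rewrite mulr0 scale0r mul0rn.
by rewrite exprS mulrDr mulrA -scalerAr eulerM scalerDr -addrA
   [X in _ = _ + X]addrC.
Qed.

Lemma exp_coefM i M : (i <= M)%N ->
  exp_coef i * exp_coef (M - i) = exp_coef M * ('C(M, i))%:R :> k.
Proof.
move=> iM; rewrite [RHS]mulrC -[exp_coef M]mulr1 alg_mul_nat mulr1.
rewrite /exp_coef -scalerAl mul1r scalerA; congr (_ *: _).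
have fact0 n : n`!%:R != 0 :> rat by rewrite pnatr_eq0 -lt0n fact_gt0.
apply: (mulfI (fact0 M)); rewrite [RHS]mulrCA mulfV // mulr1.
by rewrite -{1}(bin_fact iM) !natrM -invfM mulfK // mulf_neq0.
Qed.

(** The defect of the [ad_grouplike] relation for exp P, sorted by degree in [P]. For primitive [P]
    it vanishes term by term; for t P it is a polynomial in t. *)
Lemma exp_rel w N : (size w < N)%N -> 
  (adact (sexp SI P) T s * sexp SI P
    - (sexp SI P * T + s *: euler (sexp SI P))) w =
  \sum_(M < N) exp_coef M * (adact_binom P T s M - (P ^+ M * T + s *: euler (P ^+ M))) w.
Proof.
move=> wN; have sP := sexp_summable P0.
have oP n : order_ge n (exp_coef n *: P ^+ n).
  by have := @order_power _ _ exp_coef P 0 P0 n; rewrite addn0.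
have oF n : order_ge n (adact (exp_coef n *: P ^+ n) T s).
  exact: adact_order.
have -> : \sum_(M < N) exp_coef M * (adact_binom P T s M - (P ^+ M * T + s *: euler (P ^+ M))) w
   = \sum_(M < N) (exp_coef M *: adact_binom P T s M) w
   - \sum_(M < N) ((exp_coef M *: P ^+ M) * T + s *: euler (exp_coef M *: P ^+ M)) w.
  rewrite -sumrB; apply: eq_bigr => M _.
  by rewrite -(scalerAl (exp_coef M) (P ^+ M) T) eulerZ !seriesE; ring.
rewrite !seriesE; congr (_ - _).
  have [_ <-] := strong_op (L := fun Q => adact Q T s) (finitary_adact T s) sP.
  have [s1 <-] := strong_op (L := fun Q => Q * sexp SI P) (finitary_mull _) (order_ssum oF).
  rewrite (@order_ssumE _ _ _ N) // => [|n]; last first.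
    exact: (order_geMr _ (oF n)).
  transitivity (\sum_(n < N) \sum_(m < N)
      (adact (exp_coef n *: P ^+ n) T s * (exp_coef m *: P ^+ m)) w).
    apply: eq_bigr => n _ /=.
    have [_ <-] := strong_op (finitary_mulr (adact (exp_coef n *: P ^+ n) T s)) sP.
    rewrite (@order_ssumE _ _ _ N) // => m.
    exact: (order_geMl _ (oP m)).
  rewrite (big_triangle (f := fun n m =>
    (adact (exp_coef n *: P ^+ n) T s * (exp_coef m *: P ^+ m)) w)); last first.
    by move=> n m Nnm; apply: (order_geM (oF n) (oP m)); apply: leq_trans Nnm.
  apply: eq_bigr => M _; rewrite /adact_binom scaler_sumr series_sumE; apply: eq_bigr => i _.
  rewrite adactZ -(scalerAl (exp_coef i)) -(scalerAr (exp_coef (M - i))) scalerA.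
  by rewrite (exp_coefM (leq_ord i)) -scalerA scaler_nat.
have -> : sexp SI P * T = ssum SI (fun n => exp_coef n *: P ^+ n * T).
  by have [_ <-] := strong_op (L := fun Q => Q * T) (finitary_mull T) sP.
have [_ <-] := strong_op finitary_euler sP.
rewrite !(@order_ssumE _ _ _ N) //.
- rewrite mulr_sumr -big_split /=; apply: eq_bigr => n _.
  by rewrite !seriesE.
- by move=> n; apply: euler_order.
- by move=> n; apply: (order_geMr _ (oP n)).
Qed.

End Exponential.

Lemma sexp_ad_primitive P : ad_primitive P -> ad_grouplike (sexp SI P).
Proof.
move=> PP; have [P0 _] := PP; split=> [|T s]; first exact: sexp_coef0.
apply/eqP; rewrite -subr_eq0; apply/eqP/funext => w.
rewrite (exp_rel _ _ P0 (ltnSn (size w))) big1 // => M _.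
by rewrite adact_binom_primitive // subrr seriesE mulr0.
Qed.

(* The relations defining [ad_grouplike], written for exp(t P), are polynomial
   in t coefficient by coefficient and hold at all naturals t, since
   exp(t P) = exp(P)^t; their terms linear in t say that P is [ad_primitive]. *)
Lemma slog_ad_grouplike g : ad_grouplike g -> ad_primitive (slog SI g).
Proof.
move=> gG; have g1 := gG.1; have P0 := slog_coef0 g1.
have gE := sexp_slog g1; move: (slog SI g) P0 gE => P P0 gE.
split=> // T s; apply/funext => w.
pose q M := exp_coef M * (adact_binom P T s M - (P ^+ M * T + s *: euler (P ^+ M))) w.
have q1 : q 1%N = 0.
  (* The bound [(size w).+2] keeps index 1 in range even for the empty word. *)
  apply: (@rat_poly_eq0 _ (size w).+2 q) => // t.
  have [_ /(_ T s) tE] := ad_grouplikeX t gG.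
  rewrite -gE -sexp_scale_nat // in tE.
  have tP0 : (t%:R *: P) [::] = 0 by rewrite seriesE P0 mulr0.
  have := exp_rel T s tP0 (leqW (ltnSn (size w))).
  rewrite tE subrr => E; rewrite -[RHS]/((0 : series k I) w) E; apply: eq_bigr => M _.
  have -> : adact_binom (t%:R *: P) T s M = t%:R ^+ M *: adact_binom P T s M.
    rewrite /adact_binom scaler_sumr; apply: eq_bigr => i _.
    rewrite -scalerMnr !exprZn adactZ -(scalerAl (t%:R ^+ i)).
    rewrite -(scalerAr (t%:R ^+ (M - i))) scalerA -exprD subnKC //.
    by rewrite -ltnS.
  rewrite exprZn -(scalerAl (t%:R ^+ M)) eulerZ /q !seriesE.
  have -> (x : k) : (t%:R ^+ M : rat) *: x = t%:R ^+ M * x.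
    by rewrite -[x in LHS]mul1r scalerAl -[_ *: 1]/(GRing.in_alg k _) rmorphXn rmorph_nat.
  by ring.
have c1 : exp_coef 1 = 1 :> k.
  by have := @exp_coefS k 0; rewrite mulr1n mul1r exp_coef0.
move: q1; rewrite /q c1 mul1r.
(* In degree one the relation is [T * P + adact P T s = P * T + s *: euler P], at the word [w]. *)
rewrite /adact_binom !big_ord_recl big_ord0 /= !expr1 expr0 adact1 !mulr1 addr0.
rewrite /bracket !seriesE => /eqP; rewrite subr_eq0 => /eqP E.
by apply: (addrI ((T * P) w)); rewrite E; ring.
Qed.

Lemma group_seriesE g : group_series g <-> ad_grouplike g.
Proof.
split=> [[P PL <-]|gG]; first exact/sexp_ad_primitive/lie_series_ad_primitive.
exists (slog SI g); last exact: sexp_slog gG.1.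
by apply: ad_primitive_lie; apply: slog_ad_grouplike.
Qed.

End Dynkin.

(** * Ordered products and generation *)

(** Products over all letters need some order on an arbitrary [I]. Totality and transitivity of a
    well-order are read off minima of two and three elements, antisymmetry off their uniqueness. *)
Lemma strict_linear_order_exists (T : Type) :
  exists lt : rel T, is_strict_linear_order lt.
Proof.
have [R Rwo] := @wochoice.well_ordering_principle {classic T}.
have minR (s : seq {classic T}) x : x \in s ->
    exists2 z, z \in s & forall y, y \in s -> R z y.
  move=> xs; have [|z [[zs zmin] _]] := Rwo (mem s); first by exists x.
  by exists z.
have Rtot (x y : {classic T}) : R x y || R y x.
  have [z] := minR [:: x; y] x (mem_head _ _).
  by rewrite !inE => /orP[]/eqP-> zmin; rewrite zmin ?orbT // !inE eqxx ?orbT.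
have Rxx (x : {classic T}) : R x x by have := Rtot x x; rewrite orbb.
have Ranti (x y : {classic T}) : R x y -> R y x -> x = y.
  move=> Rxy Ryx.
  have [|z [_ zU]] := Rwo (mem [:: x; y]); first by exists x; apply: mem_head.
  by rewrite -(zU x) ?(zU y) //; split=> [|t]; rewrite !inE ?eqxx ?orbT //
    => /orP[]/eqP->.
have Rtr (y x z : {classic T}) : R x y -> R y z -> R x z.
  move=> Rxy Ryz; have [t] := minR [:: x; y; z] x (mem_head _ _).
  have inz : z \in [:: x; y; z] by rewrite !inE eqxx !orbT.
  have iny : y \in [:: x; y; z] by rewrite !inE eqxx !orbT.
  have inx : x \in [:: x; y; z] by rewrite !inE eqxx.
  rewrite !inE => /or3P[]/eqP-> tmin; first exact: tmin.
    by rewrite (Ranti x y) // tmin.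
  by rewrite -(Ranti y z) // tmin.
exists (fun x y : T => ((x : {classic T}) != y) && R x y); split.
- by move=> x; rewrite eqxx.
- move=> y x z /andP[xy Rxy] /andP[yz Ryz]; rewrite (Rtr y) // andbT.
  by apply: contraNneq yz => xz; rewrite (Ranti y z) // -xz.
move=> x y xy; have nxy : (x : {classic T}) != y by apply/eqP.
by rewrite nxy (eq_sym (y : {classic T})) nxy Rtot.
Qed.

Lemma ltn_strict_linear_order : is_strict_linear_order ltn.
Proof.
split=> [n|m n p|m n mn]; [exact: ltnn|exact: ltn_trans|].
by rewrite -neq_ltn; apply/eqP.
Qed.

Lemma strict_linear_sort (T : eqType) (lt : rel T) (s : seq T) :
  is_strict_linear_order lt -> exists2 s', sorted lt s' & s' =i s.
Proof.
move=> [irr tr tot]; pose le x y := (x == y) || lt x y.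
have le_total : total le.
  move=> x y; rewrite /le eq_sym; have [//|xy] := eqVneq y x.
  by apply: tot; apply/eqP; rewrite eq_sym.
have le_tr : transitive le.
  move=> y x z /orP[/eqP->//|xy] /orP[/eqP<-|yz]; first by rewrite /le xy orbT.
  by rewrite /le (tr y) ?orbT.
exists (sort le (undup s)) => [|x]; last by rewrite mem_sort mem_undup.
rewrite (sorted_pairwise tr).
have : pairwise [rel x y | (x != y) && le x y] (sort le (undup s)).
  rewrite pairwise_relI -(sorted_pairwise le_tr) (sort_sorted le_total) andbT.
  by rewrite -uniq_pairwise sort_uniq undup_uniq.
by apply: sub_pairwise => x y /andP[/negPf nxy]; rewrite /le nxy.
Qed.

Section OrderedProducts.
Context {k : comNzRingType} {I : Type}.
Implicit Types (P Q : series k I).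
Notation SI := (series_summability k I).
Notation S0 := (@series0 k I).

(** As [s] has no duplicates, each subsequence arises from exactly one choice of factors. This is
    the finite model of [increasing_series]. *)
Lemma prod_var_subseq (J : Type) (s : seq {classic J}) (v : seq {classic J}) :
  uniq s -> (\prod_(j <- s) (1 + series_var k j) : series k J) v = (subseq v s)%:R.
Proof.
elim: s v => [|x s IHs] v /=; first by rewrite big_nil seriesE; case: v.
case/andP=> xs us; rewrite big_cons mulrDl mul1r seriesE IHs // series_varM.
case: v => [|y v] /=; first by rewrite sub0seq addr0.
case: eqVneq => [->|yx].
  rewrite asboolT // mul1r IHs //; case: (boolP (subseq (x :: v) s)) => [xvs|].
    by have := mem_subseq xvs (mem_head _ _); rewrite (negPf xs).
  by rewrite add0r.
by rewrite asboolF ?mul0r ?addr0 //; apply/eqP.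
Qed.

Lemma multipliable_coef0 (J : Type) (f : J -> series k I) :
  multipliable SI S0 f -> forall j, (f j - 1) [::] = 0.
Proof. by case. Qed.

(** On [U] only indices in [s] contribute, and the increasing words over the sorted list [s] are
    exactly its subsequences. *)
Lemma ordered_prod_local (J : Type) (f : J -> series k I) (lt : rel J)
    (U : set (seq I)) (s : seq {classic J}) u :
  multipliable SI S0 f -> irreflexive lt -> transitive lt ->
  (forall i u, U u -> U (take i u)) -> (forall i u, U u -> U (drop i u)) ->
  sorted lt s -> (forall j, j \notin s -> forall u, U u -> (f j - 1) u = 0) ->
  U u -> ordered_prod SI S0 lt f u = (\prod_(j <- s) f j) u.
Proof.
move=> fM irr tr Utake Udrop ss s0 Uu.
have a0 := multipliable_coef0 fM; have [_ sa] := fM.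
have evP := series_ev_morphism a0 sa.
rewrite /ordered_prod series_unital_evE //.
have us : uniq s by apply: (@sorted_uniq {classic J} lt tr irr).
have -> : \prod_(j <- s) f j =
    series_ev (fun j => f j - 1) (\prod_(j <- s) (1 + series_var k j)).
  rewrite (umorph_prod evP); apply: eq_bigr => j _.
  by rewrite (umorphD evP) (umorph1 evP) series_ev_var // addrCA subrr addr0.
apply/eqP; rewrite -subr_eq0 -[X in X == 0]/((_ - _ : series k I) u) -(umorphB evP).
apply/eqP; rewrite /series_ev.
set D := (_ - _ : series k J).
suff D0 (v : seq {classic J}) : (D v *: wordprod (fun j => f j - 1) v) u = 0.
  by rewrite (series_ssumE (s := [::])) ?big_nil // => v _; apply: D0.
rewrite seriesE; have [vs|vs] := boolP (all (mem s) v); last first.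
  by rewrite (wordprod_out Utake Udrop s0) ?mulr0.
rewrite /D !seriesE prod_var_subseq // /increasing_series.
suff -> : sorted lt v = subseq v s by rewrite subrr mul0r.
apply/idP/idP => [vlt|]; last first.
  by move=> sub; apply: (@subseq_sorted {classic J} lt tr v s).
have -> : v = [seq x <- s | x \in (v : seq {classic J})].
  apply: (@irr_sorted_eq {classic J} lt tr irr) => //.
    exact: (@sorted_filter {classic J} lt tr).
  move=> x; rewrite mem_filter; case: (boolP (x \in (v : seq {classic J}))) => //.
  by move/(allP vs) => /= ->.
exact: filter_subseq.
Qed.

Lemma summable_sorted (J : Type) (f : J -> series k I) (lt : rel J) (w : seq {classic I}) :
  summable SI f -> is_strict_linear_order lt ->
  exists2 s : seq {classic J}, sorted lt s &
    forall j, j \notin s -> forall u, u \in words (size w) w -> f j u = 0.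
Proof.
move=> sf ltP; have [s us s0] := summable_on_seq (words (size w) w) sf.
have [s' ss' s'E] := @strict_linear_sort {classic J} lt s ltP.
by exists s' => // j; rewrite s'E => /s0 /allP fj u /fj /eqP.
Qed.

Lemma ordered_prod_words (J : Type) (f : J -> series k I) (lt : rel J)
    (w : seq {classic I}) :
  multipliable SI S0 f -> is_strict_linear_order lt ->
  exists s : seq {classic J},
    [/\ uniq s, forall j, j \notin s -> (f j - 1) w = 0 &
    forall u, u \in words (size w) w ->
      ordered_prod SI S0 lt f u = (\prod_(j <- s) f j) u].
Proof.
move=> fM ltP; have [irr tr tot] := ltP.
have [s ss s0] := summable_sorted w fM.2 ltP.
exists s; split; first exact: (@sorted_uniq {classic J} lt tr irr).
  by move=> j /s0; apply; apply: words_self.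
move=> u uw.
apply: (ordered_prod_local (U := [set u : seq I | u \in words (size w) w])) s0 uw => //.
  by move=> i v; apply: words_take.
by move=> i v; apply: words_drop.
Qed.

(** Products of two or more of the [f j - 1] start in degree 2n + 2, beyond the range considered. *)
Lemma ordered_prod_leading n (J : Type) (f : J -> series k I) (lt : rel J) u :
  multipliable SI S0 f -> is_strict_linear_order lt ->
  (forall j, order_ge n.+1 (f j - 1)) -> (size u <= n.+1)%N ->
  ordered_prod SI S0 lt f u = (1 + ssum SI (fun j => f j - 1)) u.
Proof.
move=> fM ltP of_ un; have [s [us s0 ->]] := ordered_prod_words u fM ltP; last first.
  exact: words_self.
rewrite seriesE (series_ssumE us s0) => {us s0}.
have f1 : forall t : seq {classic J}, (\prod_(j <- t) f j) [::] = 1.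
  elim=> [|j t IHt]; first by rewrite big_nil.
  rewrite big_cons series_mul0 IHt mulr1.
  by have := of_ j [::] isT; rewrite !seriesE => /eqP; rewrite subr_eq0 => /eqP.
elim: s => [|j s IHs]; first by rewrite !big_nil addr0.
rewrite !big_cons addrCA -IHs -[f j in LHS](subrK 1) mulrDl mul1r seriesE.
by congr (_ + _); rewrite (mul_leading _ (of_ j)) // f1 mulr1.
Qed.

Lemma ad_grouplike_ordered_prod (J : Type) (f : J -> series k I) (lt : rel J) :
  multipliable SI S0 f -> is_strict_linear_order lt ->
  (forall j, ad_grouplike (f j)) -> ad_grouplike (ordered_prod SI S0 lt f).
Proof.
move=> fM ltP fG; apply: ad_grouplike_local => w.
have [s [_ _ sE]] := ordered_prod_words w fM ltP.
exists (\prod_(j <- s) f j); first exact: ad_grouplike_prod.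
move=> u uw us; apply: sE; rewrite mem_words uw /=; exact/allP.
Qed.

(** A word has finitely many letters, so a family whose i-th member is lettered by i is summable;
    the condition survives products, hence exp, log and commutators. *)
Definition lettered (i : {classic I}) P : Prop :=
  forall w : seq {classic I}, i \notin w -> P w = 0.

Lemma letteredMl i P Q : lettered i P -> lettered i (P * Q).
Proof.
move=> iP w iw; rewrite series_mulE big1 // => j _; rewrite iP ?mul0r //.
by apply: contra iw => /mem_take.
Qed.

Lemma letteredMr i P Q : lettered i Q -> lettered i (P * Q).
Proof.
move=> iQ w iw; rewrite series_mulE big1 // => j _; rewrite iQ ?mulr0 //.
by apply: contra iw => /mem_drop.
Qed.

Lemma letteredB i P Q : lettered i P -> lettered i Q -> lettered i (P - Q).
Proof. by move=> iP iQ w iw; rewrite !seriesE iP // iQ // subrr. Qed.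

Lemma letteredZ i c P : lettered i P -> lettered i (c *: P).
Proof. by move=> iP w iw; rewrite seriesE iP // mulr0. Qed.

Lemma lettered_var i : lettered i (series_var k i).
Proof.
move=> w iw; rewrite /series_var asboolF // => wi.
by move: iw; rewrite wi mem_head.
Qed.

Lemma lettered_summable (F : I -> series k I) :
  (forall i, lettered i (F i)) -> summable SI F.
Proof.
move=> iF w; apply/finite_supportE; exists (undup (w : seq {classic I})).
  exact: undup_uniq.
by move=> i; rewrite mem_undup; apply: iF.
Qed.

Lemma series_ssum_eq (J : Type) (F G : J -> series k I) u :
  (forall j, F j u = G j u) -> ssum SI F u = ssum SI G u.
Proof. by move=> FG; apply: eq_fsbigr => j _; apply: FG. Qed.

End OrderedProducts.

(** * Generation of the group series by the exponentials of the letters *)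

Section Generation.
Context {k : comAlgType rat} {I : Type}.
Implicit Types (P Q g h : series k I).
Notation SI := (series_summability k I).
Notation S0 := (@series0 k I).

Lemma sexp_low P u : P [::] = 0 -> (size u <= 1)%N -> sexp SI P u = (1 + P) u.
Proof.
move=> P0 u1; rewrite (@sexpE _ _ P 2) // !big_ord_recl big_ord0 /= expr0 expr1.
have c1 : exp_coef 1 = 1 :> k.
  by have := @exp_coefS k 0; rewrite mulr1n mul1r exp_coef0.
by rewrite exp_coef0 c1 !mul1r addr0 seriesE.
Qed.

Lemma lettered_sexp i P : P [::] = 0 -> lettered i P -> lettered i (sexp SI P - 1).
Proof.
move=> P0 iP w iw; rewrite !seriesE (@sexpE _ _ P (size w).+1) // big_ord_recl.
rewrite expr0 exp_coef0 mul1r big1 ?addr0 ?seriesE ?subrr // => j _.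
by rewrite lift0 exprS (letteredMl _ iP) // mulr0.
Qed.

Lemma group_series_coef0 g : group_series g -> g [::] = 1.
Proof. by move/group_seriesE => -[]. Qed.

Lemma group_series_gpow g c : group_series g -> group_series (gpow SI g c).
Proof.
move=> [P PL <-]; have P0 := lie_series_coef0 PL; exists (c *: P).
  exact: lie_series_scale.
by rewrite /gpow slog_sexp.
Qed.

(** Inverses are powers, so a set closed under products and powers also contains commutators. *)
Lemma gpow_opp1 g : group_series g ->
  g * gpow SI g (-1) = 1 /\ gpow SI g (-1) * g = 1.
Proof.
move=> [P PL <-]; have P0 := lie_series_coef0 PL.
rewrite /gpow slog_sexp // scaleN1r; split; first exact: sexpN.
have NP0 : (- P) [::] = 0 by rewrite seriesE P0 oppr0.
by have := sexpN NP0; rewrite opprK.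
Qed.

Section Closure.
Variable H : set (series k I).
Hypothesis H_var : forall i, H (sexp SI (series_var k i)).
Hypothesis H_mul : forall g h, group_series g -> group_series h ->
  H g -> H h -> H (g * h).
Hypothesis H_pow : forall g c, group_series g -> H g -> H (gpow SI g c).
Hypothesis H_prod : forall (J : Type) (g : J -> series k I) (lt : rel J),
  (forall j, group_series (g j)) -> multipliable SI S0 g ->
  is_strict_linear_order lt -> (forall j, H (g j)) ->
  H (ordered_prod SI S0 lt g).

(** The closure hypotheses on [H] apply within Gr<<I>> only, so membership there is carried
    along. *)
Let K g := group_series g /\ H g.

Let K_var i : K (sexp SI (series_var k i)).
Proof. by split=> //; exists (series_var k i) => //; apply: lie_series_var. Qed.

Let K_mul g h : K g -> K h -> K (g * h).
Proof.
move=> [gG Hg] [hG Hh]; split; last exact: H_mul.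
by apply/group_seriesE; apply: ad_grouplikeM; apply/group_seriesE.
Qed.

Let K_pow g c : K g -> K (gpow SI g c).
Proof. by move=> [gG Hg]; split; [apply: group_series_gpow|apply: H_pow]. Qed.

Let K_prod (J : Type) (g : J -> series k I) (lt : rel J) :
  multipliable SI S0 g -> is_strict_linear_order lt -> (forall j, K (g j)) ->
  K (ordered_prod SI S0 lt g).
Proof.
move=> gM ltP Kg; split; last by apply: H_prod => // j; case: (Kg j).
apply/group_seriesE; apply: ad_grouplike_ordered_prod => // j.
by apply/group_seriesE; case: (Kg j).
Qed.

(* Leading terms of the closure exhaust the right-normed brackets: commutators
   with exp X_i realize the bracket with X_i, ordered products over the letters
   realize sums over i. *)
Let K_leading n Q : exists2 h, K h &
  forall u, (size u <= n.+1)%N -> h u = (1 + grade n.+1 (adact Q 0 1)) u.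
Proof.
have [lt ltP] := strict_linear_order_exists I.
elim: n Q => [|n IHn] Q.
  (* In degree one, the coefficient of [X_i] is realized as an exponent of exp X_i. *)
  pose h i := gpow SI (sexp SI (series_var k i)) (Q [:: i]).
  have X0 i : series_var k i [::] = 0 by rewrite /series_var asboolF.
  have cX0 i : (Q [:: i] *: series_var k i) [::] = 0 by rewrite seriesE X0 mulr0.
  have hE i : h i = sexp SI (Q [:: i] *: series_var k i).
    by rewrite /h /gpow slog_sexp.
  have h1 i : (h i - 1) [::] = 0 by rewrite hE !seriesE sexp_coef0 // subrr.
  have hM : multipliable SI S0 h.
    split=> //; apply: lettered_summable => i; rewrite hE.
    apply: lettered_sexp => //; apply/letteredZ/lettered_var.
  exists (ordered_prod SI S0 lt h).
    exact: (K_prod hM ltP (fun i => K_pow _ (K_var i))).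
  move=> u u1; rewrite (@ordered_prod_leading _ _ 0) // => [|j]; last exact/order_ge1.
  rewrite gradeS_adact eqxx scale1r seriesE [in RHS]seriesE; congr (_ + _).
  have -> : adsum (fun i => grade 0 (adact (shift i Q) 0 1)) = 0.
    by apply/funext => -[|x w] //=; rewrite !grade0_adact subrr.
  rewrite addr0; have [_ <-] := deg1_ssum Q.
  apply: series_ssum_eq => i; rewrite hE seriesE sexp_low // !seriesE.
  by rewrite addrAC subrr add0r.
have [h hP] := choice (fun i => let: ex_intro2 h Kh hE := IHn (shift i Q) in
  ex_intro (fun h => K h /\ forall u, (size u <= n.+1)%N ->
    h u = (1 + grade n.+1 (adact (shift i Q) 0 1)) u) h (conj Kh hE)).
pose e i := sexp SI (series_var k i).
pose e' i := gpow SI (e i) (-1).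
pose h' i := gpow SI (h i) (-1).
pose c i := e i * h i * (e' i * h' i).
have Ke i : K (e i) by exact: K_var.
have Kh i : K (h i) by case: (hP i).
have Ke' i : K (e' i) := K_pow (-1) (Ke i).
have Kh' i : K (h' i) := K_pow (-1) (Kh i).
have ee' i : e i * e' i = 1 := (gpow_opp1 (Ke i).1).1.
have hh' i : h i * h' i = 1 := (gpow_opp1 (Kh i).1).1.
have Kc i : K (c i) := K_mul (K_mul (Ke i) (Kh i)) (K_mul (Ke' i) (Kh' i)).
(* [c i - 1] is the ring commutator [V i] times a series with constant term 1, so both have the same
   leading term. *)
pose V i := (e i - 1) * (h i - 1) - (h i - 1) * (e i - 1).
have cE i : c i - 1 = V i * (e' i * h' i).
  have -> : V i = e i * h i - h i * e i.
    rewrite /V !(mulrBl, mulrBr) !mul1r !mulr1; apply/funext => w.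
    rewrite !seriesE; ring.
  by rewrite mulrBl; congr (_ - _); rewrite -mulrA (mulrA (e i)) ee' mul1r hh'.
have oe i : order_ge 1 (e i - 1).
  by apply/order_ge1; rewrite !seriesE (group_series_coef0 (Ke i).1) subrr.
pose D i := grade n.+1 (adact (shift i Q) 0 1).
have oD i : order_ge n.+1 (D i) by move=> w wn; rewrite /D /grade (ltn_eqF wn).
have oB i : order_ge n.+2 (h i - 1 - D i).
  by move=> w wn; rewrite !seriesE (hP i).2 // !seriesE -/(D i) addrAC addrK addrN.
have oh i : order_ge n.+1 (h i - 1).
  rewrite -[h i - 1](subrK (D i)); apply: order_geD => //.
  exact: order_geW (oB i).
have oA i : order_ge 2 (e i - 1 - series_var k i).
  have X0 : series_var k i [::] = 0 by rewrite /series_var asboolF.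
  move=> w wn; rewrite !seriesE /e sexp_low // seriesE !seriesE.
  by rewrite addrAC addrK subrr.
have oX (i : I) : order_ge 1 (series_var k i).
  by apply/order_ge1; rewrite /series_var asboolF.
have oV i : order_ge n.+2 (V i).
  apply: order_geB; first exact: order_geM (oe i) (oh i).
  by rewrite -addn1; apply: order_geM.
have VE i u : (size u <= n.+2)%N -> V i u = bracket (series_var k i) (D i) u.
  move=> un; apply/eqP; rewrite -subr_eq0; apply/eqP.
  rewrite -[LHS]/((V i - bracket (series_var k i) (D i)) u).
  move: (oe i) (oh i) (oA i) (oB i) (oD i) (oX i); rewrite /V.
  move: (e i - 1) (h i - 1) (D i) (series_var k i) => x y d X ox oy oA' oB' od oX'.
  (* Each factor is replaced by its leading term in turn; every error product has order at least
     [n.+3]. *)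
  have -> : x * y - y * x - bracket X d
      = (x - X) * y + X * (y - d) - ((y - d) * x + d * (x - X)).
    rewrite /bracket !(mulrDl, mulrDr, mulrN, mulNr); apply/funext => w.
    by rewrite !seriesE; ring.
  suff : order_ge n.+3 ((x - X) * y + X * (y - d) - ((y - d) * x + d * (x - X))).
    by apply.
  apply: order_geB; apply: order_geD.
  - exact: order_geM oA' oy.
  - exact: order_geM oX' oB'.
  - by rewrite -addn1; apply: order_geM.
  - by rewrite -[n.+3]addn2; apply: order_geM.
have oc i : order_ge n.+2 (c i - 1) by rewrite cE; apply: order_geMr.
have cD i u : (size u <= n.+2)%N -> (c i - 1) u = bracket (series_var k i) (D i) u.
  move=> un; rewrite cE (mul_leading _ (oV i)) // series_mul0 -VE //.
  by rewrite (group_series_coef0 (Ke' i).1) (group_series_coef0 (Kh' i).1) !mulr1.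
have cM : multipliable SI S0 c.
  split; first by move=> i; apply: (oc i).
  apply: lettered_summable => i; rewrite cE; apply: letteredMl.
  have ie : lettered i (e i - 1).
    by apply: lettered_sexp; [exact: (oX i)|exact: lettered_var].
  by apply: letteredB; [exact: letteredMl|exact: letteredMr].
exists (ordered_prod SI S0 lt c); first exact: (K_prod cM ltP Kc).
move=> u un; rewrite (@ordered_prod_leading _ _ n.+1) // seriesE [RHS]seriesE.
congr (_ + _); rewrite gradeS_adact scale0r add0r.
have [_ <-] := adsum_ssum D.
by apply: series_ssum_eq => i; apply: cD.
Qed.

(** At [T = 0], [s = 1] the relation reads [adact g 0 1 * g = euler g], so in degree n + 1 Dynkin's
    map multiplies [g] by n + 1. Hence [g] divided by n + 1 is the right input for [K_leading], and
    dividing [g] on the left by the resulting [h] raises the order. *)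
Let K_step n g : group_series g -> order_ge n.+1 (g - 1) ->
  exists p : series k I * series k I,
    [/\ K p.1, order_ge n.+1 (p.1 - 1), group_series p.2,
        order_ge n.+2 (p.2 - 1) & g = p.1 * p.2].
Proof.
move=> gG og; have [h Kh hE] := K_leading n ((n.+1%:R^-1 : rat)%:A *: g).
have g1 := group_series_coef0 gG.
have [_ /(_ 0 1) Dg] := (group_seriesE g).1 gG.
rewrite mulr0 add0r scale1r in Dg.
have oDg : order_ge n.+1 (adact g 0 1).
  by rewrite -[g](subrK 1) adactD adact1 addr0; apply: adact_order.
have oB : order_ge n.+2 (g - h).
  move=> u un; rewrite !seriesE hE // adactZ !seriesE /grade.
  case: (eqVneq (size u) n.+1) => [us|us].
    have := congr1 (fun R : series k I => R u) Dg.
    rewrite (mul_leading _ oDg) // g1 mulr1 eulerE us seriesE => ->.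
    rewrite mulrCA alg_mul_nat mulfV ?pnatr_eq0 // scale1r mul1r.
    by case: u us {un} => // x u _; rewrite add0r subrr.
  have := og u; rewrite !seriesE addr0 => -> //.
  by rewrite ltn_neqAle us.
have oh : order_ge n.+1 (h - 1).
  rewrite (_ : h - 1 = (g - 1) - (g - h)); last first.
    by apply/funext => w; rewrite !seriesE; ring.
  by apply: order_geB => //; apply: order_geW oB.
have [hh' h'h] := gpow_opp1 Kh.1; pose h' := gpow SI h (-1).
exists (h, h' * g); split=> //=.
- apply/group_seriesE/ad_grouplikeM; apply/group_seriesE => //.
  by case: (K_pow (-1) Kh).
- by rewrite -{1}h'h -mulrBr; apply: order_geMl.
by rewrite mulrA hh' mul1r.
Qed.

(** Applied to the equalizer of two group evaluations, this gives their uniqueness. *)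
Lemma group_series_ind g : group_series g -> H g.
Proof.
move=> gG.
have [step stepP] : {step : nat * series k I -> series k I * series k I &
    forall p, group_series p.2 -> order_ge p.1.+1 (p.2 - 1) ->
      [/\ K (step p).1, order_ge p.1.+1 ((step p).1 - 1), group_series (step p).2,
        order_ge p.1.+2 ((step p).2 - 1) & p.2 = (step p).1 * (step p).2]}.
  apply: (@choice _ _ (fun p q => group_series p.2 -> order_ge p.1.+1 (p.2 - 1) ->
      [/\ K q.1, order_ge p.1.+1 (q.1 - 1), group_series q.2,
        order_ge p.1.+2 (q.2 - 1) & p.2 = q.1 * q.2])) => -[n g'] /=.
  have [[g'G og']|ng'] := EM (group_series g' /\ order_ge n.+1 (g' - 1)).
    by have [q qP] := K_step g'G og'; exists q.
  (* A default pair where the hypotheses of the step fail. *)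
  by exists (1, 1) => g'G og'; case: ng'.
pose fix gs n := if n is n'.+1 then (step (n', gs n')).2 else g.
pose hs n := (step (n, gs n)).1.
have gsP n : group_series (gs n) /\ order_ge n.+1 (gs n - 1).
  elim: n => [|n [gsG ogs]].
    by split=> //; apply/order_ge1; rewrite !seriesE group_series_coef0 // subrr.
  by have [] := stepP (n, gs n) gsG ogs.
have hsP n : [/\ K (hs n), order_ge n.+1 (hs n - 1) & gs n = hs n * gs n.+1].
  by have [gsG ogs] := gsP n; have [] := stepP (n, gs n) gsG ogs.
have gE n : g = \prod_(j <- iota 0 n) hs j * gs n.
  elim: n => [|n IHn]; first by rewrite big_nil mul1r.
  rewrite -[n.+1]addn1 iotaD big_cat big_seq1 /= -mulrA addn1.
  by have [_ _ <-] := hsP n.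
have hM : multipliable SI S0 hs.
  split=> [n|]; first by have [_ /(_ [::] isT)] := hsP n.
  by apply: order_ssum => n; have [_ + _] := hsP n; apply: order_geW.
suff -> : g = ordered_prod SI S0 ltn hs.
  by apply: (K_prod hM ltn_strict_linear_order _).2 => n; have [] := hsP n.
have [irr tr _] := ltn_strict_linear_order.
apply/funext => u; pose N := size u.
rewrite (ordered_prod_local (U := [set v : seq I | (size v <= N)%N])
  (s := iota 0 N : seq {classic nat}) hM irr tr) //.
(* The remainder [gs N] agrees with 1 up to length N, so the first N factors determine the
   coefficient at [u]. *)
- rewrite {1}(gE N) -[gs N](subrK 1) mulrDr mulr1 seriesE.
  have [_ ogs] := gsP N; rewrite (order_geMl _ ogs) ?add0r //; exact: ltnSn.
- by move=> i v vN; apply: leq_trans vN; rewrite size_take_min geq_minr.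
- by move=> i v vN; apply: leq_trans vN; rewrite size_drop leq_subr.
- exact: iota_ltn_sorted.
- move=> j; rewrite (@mem_classic _ (iota 0 N)) mem_iota add0n -leqNgt => Nj v vN.
  by have [_ -> //] := hsP j; rewrite ltnS (leq_trans vN).
- exact: leqnn.
Qed.

End Closure.
End Generation.

(** * Lie and group evaluations *)

Lemma lettered_slog {k : comAlgType rat} {I : Type} i (g : series k I) :
  lettered i (g - 1) -> lettered i (slog (series_summability k I) g).
Proof.
move=> ig w iw; rewrite /slog (series_ssumE (s := [::])) ?big_nil // => n _.
by rewrite seriesE exprS (letteredMl _ ig) // mulr0.
Qed.

(** The equalizer within Lie<<I>> is a summability subalgebra containing the letters, so minimality
    applies. *)
Lemma lie_evaluation_uniq {k : comNzRingType} {A : algType k}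
    (S : summability A) (m : set A) (I : Type) (a : I -> A) ev ev' :
  is_lie_evaluation S m a ev -> is_lie_evaluation S m a ev' ->
  forall P, lie_series P -> ev P = ev' P.
Proof.
move=> [evP ea] [ev'P e'a] P PL.
pose L : set (series k I) := [set P | lie_series P /\ ev P = ev' P].
have LP := @lie_series_subalgebra k I.
have zero phi : is_strong_morphism (series_summability k I) S bracket bracket
    (@lie_series k I) m phi -> phi 0 = 0.
  move=> phiP; have := smor_linear phiP (-1) (ssub_zero LP) (ssub_zero LP).
  by rewrite scaler0 addr0 scaleN1r addNr.
suff LL : is_summability_subalgebra (series_summability k I) bracket L.
  have [] : L P by apply: PL => // i; split; [exact: lie_series_var|rewrite ea e'a].
  by [].
split.
- by split; [exact: ssub_zero LP|rewrite !zero].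
- move=> c Q T [QL Qe] [TL Te]; split; first exact: (ssub_linear LP).
  by rewrite (smor_linear evP) // (smor_linear ev'P) // Qe Te.
- move=> Q T [QL Qe] [TL Te]; split; first exact: (ssub_mul LP).
  by rewrite (smor_mul evP) // (smor_mul ev'P) // Qe Te.
move=> J v vL sv; have vL' j : lie_series (v j) by case: (vL j).
split; first exact: (ssub_ssum LP).
have [_ <-] := smor_ssum evP vL' sv; have [_ <-] := smor_ssum ev'P vL' sv.
by congr (ssum S _); apply/funext => j; case: (vL j).
Qed.

Lemma group_evaluation_uniq {k : comAlgType rat} {A : algType k}
    (S : summability A) (m : set A) (I : Type) (f : I -> A) Phi Psi :
  is_group_evaluation S m f Phi -> is_group_evaluation S m f Psi ->
  forall g, group_series g -> Phi g = Psi g.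
Proof.
move=> PhiP PsiP; apply: (group_series_ind (H := [set g | Phi g = Psi g])) => /=.
- by move=> i; rewrite (gev_var PhiP) (gev_var PsiP).
- by move=> g h gG hG E E'; rewrite (gev_mul PhiP) // (gev_mul PsiP) // E E'.
- by move=> g c gG E; rewrite (gev_pow PhiP) // (gev_pow PsiP) // E.
move=> J g lt gG gM ltP E.
have [_ <-] := gev_prod PhiP gG gM ltP; have [_ <-] := gev_prod PsiP gG gM ltP.
by congr (ordered_prod S m lt _); apply/funext => j; apply: E.
Qed.

Section Evaluations.
Context {k : comAlgType rat} {A : algType k} (S : summability A) (m : set A).
Hypothesis HA : is_summability_algebra S.
Hypothesis Hev : has_unital_evaluations S m.

Lemma unital_ev_exists (I : Type) (a : I -> A) :
  (forall i, m (a i)) -> summable S a ->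
  [/\ unital_morphism S (unital_ev S m a),
      forall P, P [::] = 0 -> m (unital_ev S m a P)
    & forall i, unital_ev S m a (series_var k i) = a i].
Proof.
move=> am sa; have [e eP] := Hev am sa.
have [evP evE] := unital_ev_morphism HA eP.
split=> // [P P0|i].
  by rewrite evE ?inE //; apply: (smor_codom eP.1).
by rewrite evE ?inE ?eP.2 // /series0 /= /series_var asboolF.
Qed.

(** The one-variable identity, evaluated at [g - 1]; a family on [unit] is summable by (SM1). *)
Lemma sexp_slog_one_plus g : one_plus m g -> sexp S (slog S g) = g.
Proof.
move=> gm; have [|evP _ evX] := @unital_ev_exists unit (fun=> g - 1) (fun=> gm).
  by have [] := summability_SM1 HA.1 (v := fun _ : unit => g - 1) finite_finset.
by have := umorph_sexp_slog evP; rewrite evX addrCA subrr addr0.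
Qed.

Section LogEvaluation.
Variables (I : Type) (f : I -> A).
Hypothesis fM : multipliable S m f.

Let b : I -> A := slog S \o f.

(** [slog S (f i)] is the image of log(1 + X_i) under the evaluation at [f - 1], and the series
    log(1 + X_i) are summable since all their words contain X_i. *)
Lemma slog_multipliable : (forall i, m (b i)) /\ summable S b.
Proof.
have [evP evm evX] := unital_ev_exists fM.1 fM.2.
move: (unital_ev S m _) evP evm evX => E EP Em EX.
have X0 i : series_var k i [::] = 0 by rewrite /series_var asboolF.
have g1 i : (1 + series_var k i) [::] = 1 by rewrite seriesE X0 addr0.
have bE : b = E \o (fun i => slog (series_summability k I) (1 + series_var k i)).
  apply/funext => i; rewrite /= (umorph_slog EP) // (umorphD EP) (umorph1 EP).
  by rewrite EX addrCA subrr addr0.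
split=> [i|]; first by rewrite bE; apply: Em; apply: slog_coef0.
rewrite bE; apply: (umorph_ssum EP _).1; apply: lettered_summable => i.
apply: lettered_slog; rewrite addrAC subrr add0r; exact: lettered_var.
Qed.

Let E : series k I -> A := unital_ev S m b.

Let EP : unital_morphism S E.
Proof. by have [bm sb] := slog_multipliable; have [] := unital_ev_exists bm sb. Qed.

Let Em P : P [::] = 0 -> m (E P).
Proof. by have [bm sb] := slog_multipliable; have [_ + _] := unital_ev_exists bm sb; apply. Qed.

Let EX i : E (series_var k i) = b i.
Proof. by have [bm sb] := slog_multipliable; have [_ _] := unital_ev_exists bm sb; apply. Qed.

Lemma unital_ev_lie : is_lie_evaluation S m b E.
Proof.
split; last exact: EX.
split.
- by move=> P /lie_series_coef0; apply: Em.
- by move=> c P Q _ _; apply: umorphP EP _ _ _.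
- by move=> P Q _ _; rewrite /bracket (umorphB EP) !(umorphM EP).
- by move=> J P _; apply: umorph_ssum.
Qed.

Let E_one_plus g : g [::] = 1 -> one_plus m (E g).
Proof.
move=> g1; rewrite /one_plus /= -(umorph1 EP) -(umorphB EP); apply: Em.
by rewrite !seriesE g1 subrr.
Qed.

Lemma unital_ev_group : is_group_evaluation S m f E.
Proof.
split.
- by move=> g /group_series_coef0; apply: E_one_plus.
- by move=> g h _ _; apply: umorphM EP _ _.
- move=> g c /group_series_coef0 g1; rewrite /gpow.
  have l0 : (c *: slog (series_summability k I) g) [::] = 0.
    by rewrite seriesE slog_coef0 // mulr0.
  by rewrite (umorph_sexp EP l0) (umorphZ EP) (umorph_slog EP g1).
- move=> J g lt gG gM ltP.
  have a0 := multipliable_coef0 gM; have sa := gM.2.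
  have evP := series_ev_morphism a0 sa.
  have EgM : multipliable S m (E \o g).
    split=> [j|]; first exact/E_one_plus/group_series_coef0.
    have [+ _] := umorph_ssum EP sa; congr (summable S _).
    by apply/funext => j; rewrite /= (umorphB EP) (umorph1 EP).
  split=> //.
  have [e eP] := Hev EgM.1 EgM.2.
  have [evP' evE'] := unital_ev_morphism HA eP.
  rewrite /ordered_prod series_unital_evE //.
  (* Substituting [g - 1] and then applying [E] is an evaluation at [E \o g - 1]; uniqueness of
     evaluations therefore gives compatibility with ordered products. *)
  pose psi P := E (series_ev (fun j => g j - 1) P).
  have psiP : is_evaluation S m (fun j => (E \o g) j - 1) psi.
    split=> [|j]; last by rewrite /psi series_ev_var // (umorphB EP) (umorph1 EP).
    split.
    + by move=> P P0; apply: Em; rewrite series_ev_coef0.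
    + by move=> c P Q _ _; rewrite /psi (umorphP evP) (umorphP EP).
    + by move=> P Q _ _; rewrite /psi (umorphM evP) (umorphM EP).
    + move=> K P _ sP; have [s1 E1] := umorph_ssum evP sP.
      have [s2 E2] := umorph_ssum EP s1.
      by split=> //; rewrite /psi -E1 -E2.
  (* Evaluations are unique on series without constant term, so the empty sequence is split off. *)
  have i0 : @series0 k J (increasing_series k lt - 1).
    by rewrite /series0 /= !seriesE subrr.
  rewrite -[increasing_series k lt](subrK 1).
  move: (increasing_series k lt - 1) i0 => P0 i0.
  rewrite (umorphD evP') (umorph1 evP').
  rewrite evE' ?inE // (evaluation_uniq eP psiP) ?inE // /psi.
  by rewrite (umorphD evP) (umorph1 evP) (umorphD EP) (umorph1 EP).
- move=> i; have X0 : series_var k i [::] = 0 by rewrite /series_var asboolF.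
  by rewrite (umorph_sexp EP X0) EX /b /= sexp_slog_one_plus //; apply: fM.1.
Qed.

End LogEvaluation.
End Evaluations.

Theorem proposition4p25 (k : comAlgType rat)
    (A : algType k) (S : summability A) (m : set A)
    (HA : is_summability_algebra S) (Hm : is_split S m)
    (Hev : has_unital_evaluations S m) :
  has_group_evaluations S m /\
  forall (I : Type) (f : I -> A), multipliable S m f ->
    (exists ev, is_lie_evaluation S m (slog S \o f) ev) /\
    forall (Phi ev : series k I -> A),
      is_group_evaluation S m f Phi ->
      is_lie_evaluation S m (slog S \o f) ev ->
      forall g, group_series g ->
        Phi g = sexp S (ev (slog (series_summability k I) g)).
Proof.
split=> [I f fM|I f fM].
  split=> [|Phi Psi PhiP PsiP]; last exact: (group_evaluation_uniq PhiP PsiP).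
  exists (unital_ev S m (slog S \o f)); exact: (unital_ev_group HA Hev fM).
have lieP := unital_ev_lie HA Hev fM.
split=> [|Phi ev PhiP evP g gG].
  by exists (unital_ev S m (slog S \o f)).
have grP := unital_ev_group HA Hev fM.
rewrite (group_evaluation_uniq PhiP grP gG).
have g1 := group_series_coef0 gG.
have gL : lie_series (slog (series_summability k I) g).
  by have [P PL <-] := gG; rewrite slog_sexp //; apply: lie_series_coef0.
have [bm sb] := slog_multipliable HA Hev fM.
have [EP _ _] := unital_ev_exists HA Hev bm sb.
rewrite (lie_evaluation_uniq evP lieP gL) -(umorph_sexp EP) ?sexp_slog //.
exact: slog_coef0.
Qed.
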